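(* Let $d\ge 1$, let $M$ be a compact metric space, $f:M\to M$ a map preserving a Borel probability measure $\nu$, $\tau:M\to\mathbb{Z}^d$ measurable, $X=M\times\mathbb{Z}^d$, $\mu=\nu\times(\text{counting measure on }\mathbb{Z}^d)$, and $T(y,z)=(f(y),z+\tau(y))$ on $X$. Suppose that $T$ satisfies a shifted mixing local limit theorem at some scale $L_n$. Then (a) $T$ is local global mixing with respect to $\mathbb{G}_U$; (b) $T$ is global global mixing with respect to $\mathbb{G}_U$.
   Context: Notation: $\tau_n(y)=\sum_{j=0}^{n-1}\tau(f^j(y))$. $X$ carries the product metric ($\mathbb{Z}^d$ discrete), $\mu(\phi)=\int\phi\,d\mu$, $\nu(\phi)=\int\phi\,d\nu$, and $\lfloor\cdot\rfloor$ is the coordinatewise lower integer part. Shifted mixing local limit theorem at scale $L_n$ ($L_n>0$, $L_n\to\infty$): there are a sequence $D_n\in\mathbb{R}^d$ and a continuous $p:\mathbb{R}^d\to[0,\infty)$ with $\int_{\mathbb{R}^d}p(z)\,dz=1$ such that for all $\phi_1,\phi_2\in C(M)$, every $\mathbb{Z}^d$-valued sequence $z_n^0$ with $(z_n^0-D_n)/L_n\to0$ and every $K<\infty$, $$\lim_{n\to\infty}\sup_{z\in\mathbb{R}^d,|z|<K}\Big|L_n^d\int\phi_1(y)\phi_2(f^n(y))\mathbf 1_{\tau_n(y)=z_n^0+\lfloor zL_n\rfloor}\,d\nu(y)-\nu(\phi_1)\nu(\phi_2)p(z)\Big|=0.$$ Cubes: a cube with center $z\in\mathbb{Z}^d$ and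 size $w\in\mathbb{Z}_+$ is $V=M\times\big((z+(-\lfloor w/2\rfloor,w-\lfloor w/2\rfloor]^d)\cap\mathbb{Z}^d\big)$. $\mathbb{G}_U$: bounded uniformly continuous $\Phi:X\to\mathbb{R}$ for which there is $\bar\Phi\in\mathbb{R}$ such that for each $\varepsilon>0$ there is $N_0$ such that every cube $V$ of size greater than $N_0$ satisfies $\big|\frac1{\mu(V)}\int_V\Phi\,d\mu-\bar\Phi\big|\le\varepsilon$. Local global mixing with respect to $\mathbb{G}_U$: for every $\phi\in L^1(\mu)$ and $\Phi\in\mathbb{G}_U$, $\lim_{n\to\infty}\int\phi(x)\Phi(T^nx)\,d\mu(x)=\mu(\phi)\bar\Phi$. Global global mixing with respect to $\mathbb{G}_U$: for all $\Phi_1,\Phi_2\in\mathbb{G}_U$, $$\lim_{n\to\infty}\limsup_{\mu(V)\to\infty}\frac1{\mu(V)}\int_V\Phi_1(x)\Phi_2(T^nx)\,d\mu=\lim_{n\to\infty}\liminf_{\mu(V)\to\infty}\frac1{\mu(V)}\int_V\Phi_1(x)\Phi_2(T^nx)\,d\mu=\bar\Phi_1\bar\Phi_2,$$ where $V$ ranges over all cubes. *)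

(* Defs.v *)
From HB Require Import structures.
From mathcomp Require Import all_boot all_order all_algebra.
From mathcomp Require Import all_classical all_reals all_analysis.
Set Implicit Arguments.
Unset Strict Implicit.
Unset Printing Implicit Defensive.
Import Order.TTheory GRing.Theory Num.Theory.
Import numFieldNormedType.Exports.
Local Open Scope classical_set_scope.
Local Open Scope ring_scope.

(* Metric spaces whose measurable sets are exactly the Borel sets. *)
HB.mixin Record Measurable_isBorel (disp : measure_display) (R : realType) M
    & Metric R M & Measurable disp M := {
  measurable_borelE : @measurable disp M = <<s @open M >>
}.

#[short(type="borelMetricType")]
HB.structure Definition BorelMetric (disp : measure_display) (R : realType) :=
  { M of Metric R M & Measurable disp M & Measurable_isBorel disp R M }.

(* An alias of ['rV[int]_d], so that it can carry the discrete metric and the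
   discrete sigma-algebra. *)
Definition Zd (d : nat) : Type := 'rV[int]_d.

HB.instance Definition _ d := GRing.Zmodule.copy (Zd d) 'rV[int]_d.
HB.instance Definition _ d := Countable.copy (Zd d) 'rV[int]_d.
HB.instance Definition _ d := isPointed.Build (Zd d) 0.
HB.instance Definition _ d := hasNbhs.Build (Zd d) principal_filter.
HB.instance Definition _ d := Discrete_ofNbhs.Build (Zd d) erefl.
HB.instance Definition _ d := DiscreteUniform_ofNbhs.Build (Zd d).
HB.instance Definition _ {R : numDomainType} d :=
  @DiscretePseudoMetric_ofUniform.Build R (Zd d).
HB.instance Definition _ d := @isMeasurable.Build default_measure_display (Zd d)
  discrete_measurable discrete_measurable0
  discrete_measurableC discrete_measurableU.

Section counting_Zd.
Context (R : realType) (d : nat).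

Definition counting_Zd : set (Zd d) -> \bar R := counting.

HB.instance Definition _ := Measure.on counting_Zd.

Let counting_Zd_sigma_finite : sigma_finite setT counting_Zd.
Proof.
exists (fun n => [set z : Zd d | (pickle z < n.+1)%N]) => [|n].
  by apply/seteqP; split=> // z _; exists (pickle z) => /=.
split=> //; rewrite /counting_Zd /counting asboolT ?ltry//.
have -> : [set z : Zd d | (pickle z < n.+1)%N] = pickle @^-1` `I_n.+1 by [].
apply: finite_preimage; last exact: finite_II.
by move=> x y _ _; exact: (pcan_inj (@pickleK (Zd d))).
Qed.

HB.instance Definition _ := Measure_isSigmaFinite.Build _ _ _ counting_Zd
  counting_Zd_sigma_finite.

End counting_Zd.

(* Lebesgue measure on R^n, as the n-fold product of the Lebesgue measure on R,
   carried by the product sigma-algebra of [n.-tuple (measurableTypeR R)]. *)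
Section lebesgue_tuple.
Local Open Scope ereal_scope.
Context (R : realType).
Local Notation RT := (measurableTypeR R).

Definition cons_pair n (x : RT * n.-tuple RT) : n.+1.-tuple RT :=
  [tuple of x.1 :: x.2].

Lemma measurable_cons_pair n : measurable_fun setT (@cons_pair n).
Proof. exact: (measurable_cons measurable_fst measurable_snd). Qed.

Section step.
Variables (n : nat) (m : {sigma_finite_measure set (n.-tuple RT) -> \bar R}).

Definition lebesgue_step : set (n.+1.-tuple RT) -> \bar R :=
  pushforward ((@lebesgue_measure R : set RT -> \bar R) \x m) (@cons_pair n).

Let measurable_pre A : measurable A -> measurable (@cons_pair n @^-1` A).
Proof. by move=> mA; rewrite -[X in measurable X]setTI; exact: measurable_cons_pair. Qed.

Let step0 : lebesgue_step set0 = 0.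
Proof. by rewrite /lebesgue_step /pushforward preimage_set0 measure0. Qed.

Let step_ge0 A : 0 <= lebesgue_step A.
Proof. by rewrite /lebesgue_step /pushforward measure_ge0. Qed.

Let step_sigma_additive : semi_sigma_additive lebesgue_step.
Proof.
move=> F mF tF mUF; rewrite /lebesgue_step /pushforward preimage_bigcup.
apply: measure_semi_sigma_additive.
- by move=> k; exact: measurable_pre.
- apply/trivIsetP => /= i j _ _ ij; rewrite -preimage_setI.
  by move/trivIsetP : tF => /(_ _ _ _ _ ij) ->//; rewrite preimage_set0.
- by rewrite -preimage_bigcup; exact: measurable_pre.
Qed.

HB.instance Definition _ := isMeasure.Build _ _ _ lebesgue_step
  step0 step_ge0 step_sigma_additive.

Let step_sigma_finite : sigma_finite setT lebesgue_step.
Proof.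
have [u mu uK] : exists2 u : n.+1.-tuple RT -> RT * n.-tuple RT,
    measurable_fun setT u & cancel (@cons_pair n) u.
  exists (fun t => (tnth t ord0, [tuple of behead t])).
    apply/measurable_fun_pairP; split.
      exact: (@measurable_tnth _ RT n.+1 ord0).
    exact: (@measurable_behead _ RT n).
  by move=> [x t]; congr pair; exact/val_inj.
have /sigma_finiteP[F [TF ndF mF]] := sigma_finiteT (@lebesgue_measure R).
have /sigma_finiteP[G [TG ndG mG]] := sigma_finiteT m.
exists (fun k => u @^-1` (F k `*` G k)) => [|k].
  rewrite -preimage_bigcup -[LHS](preimage_setT u) -setXTT TF TG; congr (_ @^-1` _).
  apply/seteqP; split=> [[x y] [/= [k _ Fkx] [l _ Gly]]|[x y] [k _ [/= Fx Gy]]].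
    exists (maxn k l) => //; split.
      by move: x Fkx; exact/subsetPset/ndF/leq_maxl.
    by move: y Gly; exact/subsetPset/ndG/leq_maxr.
  by split; exists k.
have [mFk Fkoo] := mF k; have [mGk Gkoo] := mG k; split.
  by rewrite -[X in measurable X]setTI; apply: mu => //; exact: measurableX.
rewrite /lebesgue_step /pushforward (_ : _ @^-1` _ = F k `*` G k)//.
  by rewrite product_measure1E// lte_mul_pinfty// ge0_fin_numE.
by apply/funext => x; rewrite /preimage/= uK.
Qed.

HB.instance Definition _ := Measure_isSigmaFinite.Build _ _ _ lebesgue_step
  step_sigma_finite.
End step.

Fixpoint lebesgue_tuple n : {sigma_finite_measure set (n.-tuple RT) -> \bar R} :=
  match n with
  | 0 => @dirac _ (0.-tuple RT) [tuple] R
  | k.+1 => lebesgue_step (lebesgue_tuple k)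
  end.

Lemma lebesgue_tuple_box n (a b : 'I_n -> R) : (forall i, a i <= b i)%R ->
  lebesgue_tuple n [set t | forall i, a i < tnth t i <= b i]%R =
  (\prod_(i < n) (b i - a i))%R%:E.
Proof.
elim: n a b => [|n IH] a b ab.
  rewrite big_ord0 /= diracE mem_set//=; by case.
pose B := [set t : n.-tuple RT |
  forall i, a (lift ord0 i) < tnth t i <= b (lift ord0 i)]%R.
have mB : measurable B.
  rewrite (_ : B = \bigcap_(i in [set: 'I_n])
     ((fun t : n.-tuple RT => tnth t i) @^-1`
        `]a (lift ord0 i), b (lift ord0 i)])).
    apply: fin_bigcap_measurable; first exact: finite_finset.
    move=> i _; rewrite -[X in measurable X]setTI.
    exact: (@measurable_tnth _ R n i).
  apply/seteqP; split=> [t Bt i _|t Bt i] /=; rewrite ?in_itv/=; first exact: Bt.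
  by have /= := Bt i I; rewrite in_itv.
rewrite big_ord_recl EFinM -IH; last by move=> i; exact: ab.
have -> : (b ord0 - a ord0)%:E = lebesgue_measure `]a ord0, b ord0].
  rewrite lebesgue_measure_itv/= lte_fin.
  have := ab ord0; rewrite le_eqVlt => /predU1P[->|->]; last by rewrite EFinB.
  by rewrite ltxx subrr.
rewrite -[RHS](product_measure1E (@lebesgue_measure R) (lebesgue_tuple n))//.
rewrite /= /lebesgue_step /pushforward; congr (_ \x _).
apply/seteqP; split=> [[x t] /= h|[x t] [/= hx ht] i].
  split=> /=.
    by rewrite in_itv; exact: (h ord0).
  by move=> i; have := h (lift ord0 i); rewrite tnthS.
case: (unliftP ord0 i) => [j|] ->; first by rewrite tnthS; exact: ht.
by move: hx; rewrite in_itv.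
Qed.

End lebesgue_tuple.

Section LLT.
Context (disp : measure_display) (R : realType) (d : nat).
Context (M : borelMetricType disp R).
Variables (nu : probability M R) (f : M -> M) (tau : M -> Zd d).

Definition skew_product (x : M * Zd d) : M * Zd d := (f x.1, x.2 + tau x.1).

Definition birkhoff_sum (n : nat) (y : M) : Zd d :=
  \sum_(j < n) tau (iter j f y).

Definition Zd_to_Rd (z : Zd d) : 'rV[R]_d := map_mx intr (z : 'rV[int]_d).

Definition floor_Rd (z : 'rV[R]_d) : Zd d := map_mx Num.floor z.

(* [K] ranges over the positive reals only: for [K <= 0] the supremum would be
   that of the empty set, [-oo]. The norm on ['rV[R]_d] is the sup norm. *)
Definition shifted_mixing_LLT (L : nat -> R) : Prop :=
  [/\ forall n, 0 < L n,
      L @ \oo --> +oo &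
      exists (D : nat -> 'rV[R]_d) (p : 'rV[R]_d -> R),
        [/\ continuous p,
            forall z, 0 <= p z,
            (\int[lebesgue_tuple R d]_t (p (\row_i tnth t i))%:E = 1)%E &
            forall phi1 phi2 : M -> R, continuous phi1 -> continuous phi2 ->
            forall z0 : nat -> Zd d,
              (fun n => (L n)^-1 *: (Zd_to_Rd (z0 n) - D n)) @ \oo
                --> (0 : 'rV[R]_d) ->
            forall K : R, 0 < K ->
              (fun n => ereal_sup [set
                 `| L n ^+ d * \int[nu]_y (phi1 y * phi2 (iter n f y) *
                      \1_[set y' | birkhoff_sum n y' =
                                   z0 n + floor_Rd (L n *: z)] y)
                    - (\int[nu]_y phi1 y) * (\int[nu]_y phi2 y) * p z |%:E
                 | z in [set z : 'rV[R]_d | `|z| < K]]) @ \oo --> 0%E ] ].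

End LLT.

Section mixing.
Context (disp : measure_display) (R : realType) (d : nat).
Context (M : borelMetricType disp R).

Definition extension_measure (nu : probability M R) :
  {measure set (M * Zd d) -> \bar R} := (nu \x @counting_Zd R d)%E.

Definition Zd_coord (z : Zd d) (i : 'I_d) : int := (z : 'rV[int]_d) 0 i.

Definition cube (z : Zd d) (w : nat) : set (M * Zd d) :=
  [set x | forall i : 'I_d,
     Zd_coord z i - w./2%:Z < Zd_coord x.2 i <= Zd_coord z i + (w - w./2)%:Z].

Variables (mu : {measure set (M * Zd d) -> \bar R}).

Definition cube_average (F : M * Zd d -> R) (z : Zd d) (w : nat) : R :=
  (fine (mu (cube z w)))^-1 * \int[mu]_(x in cube z w) F x.

Definition has_average (Phi : M * Zd d -> R) (c : R) : Prop :=
  forall eps : R, 0 < eps -> exists N0 : nat, forall (z : Zd d) (w : nat),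
    (N0 < w)%N -> `| cube_average Phi z w - c | <= eps.

Definition GU : set (M * Zd d -> R) :=
  [set Phi | [/\ bounded_fun Phi, unif_continuous Phi &
                 exists c, has_average Phi c]].

(* Cubes are indexed by their center and size. *)
Definition large_cubes : set_system (Zd d * nat) :=
  filter_from [set: R] (fun A => [set c | (A%:E < mu (cube c.1 c.2))%E]).

Variables (T : M * Zd d -> M * Zd d) (G : set (M * Zd d -> R)).

Definition local_global_mixing : Prop :=
  forall (phi Phi : M * Zd d -> R) (c : R),
    mu.-integrable setT (EFin \o phi) -> G Phi -> has_average Phi c ->
    (fun n => \int[mu]_x (phi x * Phi (iter n T x))) @ \oo
      --> (\int[mu]_x phi x) * c.

Definition global_global_mixing : Prop :=
  forall (Phi1 Phi2 : M * Zd d -> R) (c1 c2 : R),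
    G Phi1 -> G Phi2 -> has_average Phi1 c1 -> has_average Phi2 c2 ->
    let avg n (c : Zd d * nat) :=
      (cube_average (fun x => Phi1 x * Phi2 (iter n T x)) c.1 c.2)%:E in
    (fun n => limf_esup (avg n) large_cubes) @ \oo --> (c1 * c2)%:E /\
    (fun n => limf_einf (avg n) large_cubes) @ \oo --> (c1 * c2)%:E.

End mixing.

(* Main.v *)
Require Import Defs.
From mathcomp Require Import all_boot all_order all_algebra.
From mathcomp Require Import all_classical all_reals all_analysis.
From mathcomp Require Import measurable_realfun.
From mathcomp Require Import zify ring lra.
Set Implicit Arguments.
Unset Strict Implicit.
Unset Printing Implicit Defensive.
Import Order.TTheory GRing.Theory Num.Theory.
Import numFieldNormedType.Exports.
Local Open Scope classical_set_scope.
Local Open Scope ring_scope.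

(** The proof tests the Birkhoff sums [S_n] of [tau] against observables which
    have averages over large cubes.

    The limit density [p] being continuous with integral 1, finitely many boxes
    of small mesh carry almost all its mass and [p] is almost constant on each
    of them ([riemann_sum_density]). Transported to [Zd d] by the local limit
    theorem, this says that [S_n] is, up to a small error, uniformly distributed
    on each of finitely many disjoint cubes whose size tends to infinity with
    [n], even jointly with [g(y)] and [h(f^n y)] for continuous [g] and [h]
    ([block_LLT]). The side of the cubes is taken to be an integer, so that they
    are cubes in the sense of the definition of averages.

    Let now [Phi] have average [c]. Splitting the integral of
    [g(y) Phi(f^n y, z + S_n y)] according to the value [w] of [S_n]
    ([orbit_integral_split]) turns it into a sum of correlations of [g] with the
    fibers [Phi(., z + w)]. These fibers form a totally bounded family
    ([fibers_totally_bounded]), so that the block limit theorem applies to all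
    of them uniformly, and on each block it remains to average
    [nu(Phi(., z + w))], which gives nearly [c] since the block is a large cube.
    The integral therefore tends to [nu(g) c], uniformly in [z]
    ([equidistribution_continuous]).

    Local global mixing follows by density of continuous functions in [L^1]
    ([L1_approximable_integrable]), Fubini and dominated convergence over the
    levels. Global global mixing follows by applying the uniform statement to
    the fibers of [Phi1], again through total boundedness
    ([fiber_averages_mixing]), and averaging over the levels of a large cube. *)

(** * Measurability and integrability *)

Lemma borel_open_measurable (disp : measure_display) (R : realType)
    (M : borelMetricType disp R) (A : set M) : open A -> measurable A.
Proof. by move=> oA; rewrite measurable_borelE; exact: sub_sigma_algebra. Qed.

Lemma borel_continuous_measurable (disp : measure_display) (R : realType)
    (M : borelMetricType disp R) (g : M -> R) :
  continuous g -> measurable_fun setT g.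
Proof.
move=> /continuousP cg; apply: (measurability _ (RGenOpens.measurableE R)).
move=> _ [_ [a [b ->] <-]]; rewrite setTI.
exact/borel_open_measurable/cg/interval_open.
Qed.

Lemma bounded_integrable (disp : measure_display) (R : realType)
    (T : measurableType disp) (nu : {finite_measure set T -> \bar R})
    (g : T -> R) (B : R) :
  measurable_fun setT g -> (forall y, `|g y| <= B) ->
  nu.-integrable setT (EFin \o g).
Proof.
move=> mg gB; apply: measurable_bounded_integrable => //.
  by rewrite -ge0_fin_numE// fin_num_measure.
exists B; split; first exact: num_real.
by move=> x Bx y _ /=; rewrite (le_trans (gB y))// ltW.
Qed.

Lemma prob_Rintegral_cst (disp : measure_display) (R : realType)
    (T : measurableType disp) (nu : probability T R) (c : R) :
  \int[nu]_(y in setT) c = c.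
Proof.
rewrite Rintegral_cst//; have /= -> := probability_setT nu.
by rewrite mulr1.
Qed.

Lemma normr_Rintegral_bounded (disp : measure_display) (R : realType)
    (T : measurableType disp) (nu : probability T R)
    (g : T -> R) (B : R) :
  measurable_fun setT g -> (forall y, `|g y| <= B) ->
  `|\int[nu]_y g y| <= B.
Proof.
move=> mg gB; have ig := bounded_integrable nu mg gB.
apply: le_trans (le_normr_Rintegral _ ig) _ => //.
rewrite -[leRHS](prob_Rintegral_cst nu); apply: le_Rintegral => //.
  exact: (integrable_norm ig).
by apply: (@bounded_integrable _ _ _ nu (cst B) `|B|) => //.
Qed.

Lemma Rintegral_sum (disp : measure_display) (R : realType)
    (T : measurableType disp) (mu : {measure set T -> \bar R})
    (K : finType) (F : K -> T -> R) :
  (forall k, mu.-integrable setT (EFin \o F k)) ->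
  \int[mu]_x (\sum_k F k x) = \sum_k \int[mu]_x F k x.
Proof.
move=> iF; rewrite /Rintegral sum_fine; last first.
  by move=> k _; apply: integrable_fin_num (iF k).
congr fine; rewrite -(integral_sum _ iF)//.
by apply: eq_integral => x _; rewrite /= sumEFin.
Qed.

Lemma integrableM_bounded (disp : measure_display) (R : realType)
    (T : measurableType disp) (mu : {measure set T -> \bar R})
    (k u : T -> R) (B : R) :
  mu.-integrable setT (EFin \o k) -> measurable_fun setT u ->
  (forall x, `|u x| <= B) -> mu.-integrable setT (EFin \o (fun x => k x * u x)).
Proof.
move=> ik mU uB; have /integrableP[/measurable_EFinP mk _] := ik.
apply: (le_integrable measurableT _ _ (integrableZr measurableT B ik)) => //.
  exact/measurable_EFinP/measurable_funM.
move=> x _ /=; rewrite lee_fin !normrM ler_wpM2l//.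
exact: le_trans (uB x) (ler_norm B).
Qed.

(** Every subset of the countable space [Zd d] is measurable, so measurability
    of maps into, or out of a product with, [Zd d] can be tested fiber by
    fiber. *)
Lemma measurable_fun_Zd (disp : measure_display) (T : measurableType disp)
    (d : nat) (h : T -> Zd d) :
  (forall z, measurable (h @^-1` [set z])) -> measurable_fun setT h.
Proof.
move=> mh _ A _; rewrite setTI.
rewrite (_ : h @^-1` A = \bigcup_(z in A) (h @^-1` [set z])).
  rewrite bigcup_mkcond; apply: countable_bigcupT_measurable => [|z].
    exact: countableP.
  by case: ifP.
apply/seteqP; split=> [y Ay|y [z Az /= ->]//].
by exists (h y).
Qed.

Lemma measurable_fun_slices (disp disp' : measure_display)
    (T : measurableType disp) (T' : measurableType disp') (d : nat)
    (F : T * Zd d -> T') :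
  (forall z, measurable_fun setT (fun y => F (y, z))) -> measurable_fun setT F.
Proof.
move=> mF _ A mA; rewrite setTI.
rewrite (_ : F @^-1` A =
    \bigcup_z (((fun y => F (y, z)) @^-1` A) `*` [set z])).
  apply: countable_bigcupT_measurable => [|z].
    exact: countableP.
  apply: measurableX => //.
  by rewrite -[X in measurable X]setTI; exact: mF.
by apply/seteqP; split=> [[y z] /= Ay|[y z] [w _ [/= + ->]]//]; exists z.
Qed.

Lemma measurable_fun_slice (disp disp' : measure_display)
    (T : measurableType disp) (T' : measurableType disp') (d : nat)
    (F : T * Zd d -> T') (z : Zd d) :
  measurable_fun setT F -> measurable_fun setT (fun y => F (y, z)).
Proof. by move=> mF; apply: measurableT_comp => //. Qed.

(** * Orbits of the skew product *)

Section skew.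
Context (disp : measure_display) (R : realType) (d : nat).
Context (M : borelMetricType disp R).
Variables (f : M -> M) (tau : M -> Zd d).
Hypotheses (mf : measurable_fun setT f) (mtau : measurable_fun setT tau).

Lemma measurable_iter n : measurable_fun setT (iter n f).
Proof.
elim: n => [|n IH] /=; first exact: measurable_id.
exact: (measurableT_comp mf IH).
Qed.

Lemma measurable_ZdD (h k : M -> Zd d) : measurable_fun setT h ->
  measurable_fun setT k -> measurable_fun setT (fun y => h y + k y).
Proof.
move=> mh mk; have mD : measurable_fun setT (fun p : Zd d * Zd d => p.1 + p.2).
  by apply: measurable_fun_slices => z.
apply: (measurableT_comp mD (g := fun y => (h y, k y))).
by apply/measurable_fun_pairP; split.
Qed.

Lemma measurable_birkhoff_sum n : measurable_fun setT (birkhoff_sum f tau n).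
Proof.
elim: n => [|n IH].
  rewrite (_ : birkhoff_sum _ _ _ = cst 0)//.
  by apply/funext => y; rewrite /birkhoff_sum big_ord0.
rewrite (_ : birkhoff_sum _ _ _ =
    fun y => birkhoff_sum f tau n y + tau (iter n f y)); last first.
  by apply/funext => y; rewrite /birkhoff_sum big_ord_recr.
apply: measurable_ZdD => //; exact: (measurableT_comp mtau (measurable_iter n)).
Qed.

Lemma iter_skew_product n y z :
  iter n (skew_product f tau) (y, z) = (iter n f y, z + birkhoff_sum f tau n y).
Proof.
elim: n => [|n IH] /=; first by rewrite /birkhoff_sum big_ord0 addr0.
by rewrite IH /skew_product /= /birkhoff_sum big_ord_recr /= addrA.
Qed.

Lemma measurable_orbit (Phi : M * Zd d -> R) n z : measurable_fun setT Phi ->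
  measurable_fun setT
    (fun y => Phi (iter n f y, z + birkhoff_sum f tau n y)).
Proof.
move=> mPhi; apply: (measurableT_comp mPhi); apply/measurable_fun_pairP; split.
  exact: measurable_iter.
by apply: measurable_ZdD => //; exact: measurable_birkhoff_sum.
Qed.

End skew.

(** * Integrals over cubes *)

Section slices.
Context (disp : measure_display) (R : realType) (d : nat).
Context (M : borelMetricType disp R) (nu : probability M R).
Local Notation mu := (extension_measure d nu).

Lemma counting_Zd1 (z : Zd d) : @counting_Zd R d [set z] = 1%E.
Proof.
rewrite /counting_Zd /counting asboolT; last exact: finite_set1.
by rewrite fset_set1 finmap.cardfs1.
Qed.

Lemma extension_measure_slice (A : set M) (z : Zd d) : measurable A ->
  mu (A `*` [set z]) = nu A.
Proof.
move=> mA; rewrite /extension_measure /= product_measure1E//.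
by rewrite [X in (_ * X)%E]counting_Zd1 mule1.
Qed.

Lemma integral_slice (F : M * Zd d -> R) (B : R) (z : Zd d) :
  measurable_fun setT F -> (forall x, `|F x| <= B) ->
  (\int[mu]_(x in setT `*` [set z]) (F x)%:E = \int[nu]_y (F (y, z))%:E)%E.
Proof.
move=> mF FB; set S := setT `*` [set z].
have mS : measurable S by exact: measurableX.
have iF : mu.-integrable setT ((EFin \o F) \_ S).
  apply/(integrable_mkcond _ mS)/measurable_bounded_integrable => //.
  - by rewrite extension_measure_slice// probability_setT ltry.
  - exact: measurable_funTS.
  - exists B; split; first exact: num_real.
    by move=> x Bx y _ /=; rewrite (le_trans (FB y))// ltW.
(* Fubini: integrating over [M] first leaves a function on [Zd d] supported by
   the singleton [z], which has counting measure 1. *)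
rewrite integral_mkcond -(integral21_prod_meas1 iF) /fubini_G /=.
rewrite (_ : (fun y => _) =
    (fun w => if w \in [set z] then \int[nu]_y (F (y, z))%:E else 0)%E);
  last first.
  apply/funext => w; case: ifPn => [|]; rewrite ?inE/= => wz.
    apply: eq_integral => y _; rewrite /patch mem_set wz//.
  rewrite integral0_eq// => y _; rewrite /patch memNset// => -[_ /= wz'].
  by move: wz; rewrite wz' in_set1 eqxx.
rewrite -[LHS](integral_mkcond [set z] (cst _)) integral_cst//.
by rewrite [X in (_ * X)%E]counting_Zd1 mule1.
Qed.

Lemma integral_slices (K : finType) (pt : K -> Zd d) (F : M * Zd d -> R)
    (B : R) :
  injective pt -> measurable_fun setT F -> (forall x, `|F x| <= B) ->
  (\int[mu]_(x in [set x | exists k, x.2 = pt k]) (F x)%:E)%E =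
  (\sum_k \int[nu]_y F (y, pt k))%:E.
Proof.
move=> ipt mF FB.
have -> : [set x : M * Zd d | exists k, x.2 = pt k] =
    \big[setU/set0]_(k <- index_enum K) (setT `*` [set pt k]).
  rewrite -bigcup_seq; apply/seteqP; split=> [x [k /= xk]|x [k _ [_ /= xk]]].
    by exists k => //=; rewrite mem_index_enum.
  by exists k.
rewrite integral_bigsetU_EFin//; last 4 first.
- by move=> k; exact: measurableX.
- exact: index_enum_uniq.
- apply/trivIsetP => k l _ _ kl; apply/seteqP; split=> //.
  move=> -[y w] [[_ /= ->] [_ /=]].
  by move/ipt/eqP; rewrite (negbTE kl).
- exact/measurable_EFinP/measurable_funTS.
rewrite (eq_bigr (fun k => (fine (\int[nu]_y (F (y, pt k))%:E))%:E)).
  by rewrite sumEFin.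
move=> k _; rewrite (integral_slice _ mF FB) fineK//.
apply: integrable_fin_num => //.
apply: (@bounded_integrable _ _ _ nu (fun y => F (y, pt k)) B) => //.
exact: measurable_fun_slice.
Qed.

(** The points of the cube of center [z] and size [w], indexed by the
    functions from the coordinates to [{0, ..., w - 1}]. *)
Definition cube_point (z : Zd d) (w : nat) (k : {ffun 'I_d -> 'I_w}) : Zd d :=
  (\row_i (Zd_coord z i - w./2%:Z + 1 + (k i)%:Z) : 'rV[int]_d).

Lemma cube_point_inj z w : injective (@cube_point z w).
Proof.
move=> k l /matrixP kl; apply/ffunP => i; apply: val_inj => /=.
by have := kl ord0 i; rewrite !mxE => /addrI[].
Qed.

(** Cubes are translated with their centers. *)
Lemma cube_pointD v z w k : cube_point (v + z) k = v + @cube_point z w k.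
Proof.
by apply/matrixP => i j; rewrite !mxE /Zd_coord mxE ord1 !addrA.
Qed.

Lemma cubeE z w :
  @cube disp R d M z w = [set x | exists k, x.2 = @cube_point z w k].
Proof.
apply/seteqP; split=> [x xz|x [k xk] i]; last first.
  have -> : Zd_coord x.2 i = Zd_coord z i - w./2%:Z + 1 + (k i)%:Z.
    by rewrite xk [LHS]mxE.
  by have := ltn_ord (k i); move: (Zd_coord z i) => a; lia.
have kP i : (`|(Zd_coord x.2 i - (Zd_coord z i - w./2%:Z + 1))%R|%N < w)%N.
  by have := xz i; lia.
exists [ffun i => Ordinal (kP i)].
apply/matrixP => i j; rewrite ord1 mxE ffunE/=.
by have := xz j; rewrite /Zd_coord; lia.
Qed.

Lemma measurable_cube z w : measurable (@cube disp R d M z w).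
Proof.
rewrite cubeE (_ : [set _ | _] =
    setT `*` [set v | exists k, v = @cube_point z w k]).
  exact: measurableX.
by apply/seteqP; split=> [x //|x [_ //]].
Qed.

Lemma mu_cube z w : mu (cube z w) = (w ^ d)%:R%:E.
Proof.
rewrite -[LHS]mul1e -(integral_cst mu (measurable_cube z w)) cubeE.
rewrite (@integral_slices _ (@cube_point z w) (cst 1) 1)//; last 2 first.
- exact: cube_point_inj.
- by move=> x; rewrite normr1.
under eq_bigr do rewrite prob_Rintegral_cst.
by rewrite sumr_const card_ffun !card_ord.
Qed.

Lemma cube_averageE (F : M * Zd d -> R) (B : R) z w :
  measurable_fun setT F -> (forall x, `|F x| <= B) ->
  cube_average mu F z w =
  (w ^ d)%:R^-1 * \sum_k \int[nu]_y F (y, @cube_point z w k).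
Proof.
move=> mF FB; rewrite /cube_average mu_cube /= cubeE.
by rewrite /Rintegral (integral_slices _ mF FB)//; exact: cube_point_inj.
Qed.

End slices.

(** * Continuous functions of row vectors *)

Lemma rV_norm_le (R : realType) (d : nat) (v : 'rV[R]_d) (e : R) :
  0 <= e -> (forall i, `|v ord0 i| <= e) -> `|v| <= e.
Proof.
move=> e0 ve; rewrite [leLHS]/Num.norm /= mx_normrE.
apply/bigmax_leP; split=> //.
by move=> [i j] _ /=; rewrite ord1.
Qed.

Lemma rV_norm_ge (R : realType) (d : nat) (v : 'rV[R]_d) i :
  `|v ord0 i| <= `|v|.
Proof.
rewrite [leRHS]/Num.norm /= mx_normrE; apply/bigmax_geP; right => /=.
by exists (ord0, i).
Qed.

Lemma closed_ball_compact (R : realType) (d : nat) (K : R) :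
  compact [set v : 'rV[R]_d | `|v| <= K].
Proof.
apply: bounded_closed_compact.
  exists K; split; first exact: num_real.
  by move=> x Kx v /= /le_trans; apply; exact: ltW.
have -> : [set v : 'rV[R]_d | `|v| <= K] =
  (fun v => `|v|) @^-1` [set x | x <= K] by [].
by apply: closed_comp => [? _|]; [exact: norm_continuous|exact: closed_le].
Qed.

(** A continuous function is uniformly continuous near a compact set: only one
    of the two points is required to lie in the compact set. *)
Lemma compact_uniform_continuity (R : realType) (V : normedModType R)
    (C : set V) (p : V -> R) (eta : R) :
  compact C -> continuous p -> 0 < eta ->
  exists2 delta, 0 < delta & forall x y, C x -> `|x - y| <= delta ->
    `|p x - p y| <= eta.
Proof.
move=> /compact_near_coveringP cC cp eta0.
have : \forall delta \near (0 : R)^'+, C `<=`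
    [set x | forall y, `|x - y| <= delta -> `|p x - p y| <= eta].
  apply: cC => x Cx.
  have /cvgrPdist_lt/(_ (eta / 2)) := cp x.
  rewrite divr_gt0// => /(_ isT)/nbhs_ballP[e /= e0 xe].
  exists (ball x (e / 2), [set delta | delta < e / 2]) => /=.
    split; first by apply/nbhs_ballP; exists (e / 2) => //=; exact: divr_gt0.
    by apply: nbhs_right_lt; exact: divr_gt0.
  move=> [x' delta] /= [xx' de] y x'y.
  have px' : `|p x - p x'| < eta / 2.
    apply: xe; apply: le_ball xx'.
    by rewrite ler_pdivrMr// ler_peMr ?(ltW e0)// ler1n.
  have py : `|p x - p y| < eta / 2.
    apply: xe; rewrite -ball_normE /=; move: xx'; rewrite -ball_normE /= => xx'.
    rewrite -(subrKA x') (le_lt_trans (ler_normD _ _))// [ltRHS]splitr ltrD//.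
    exact: le_lt_trans x'y _.
  rewrite -(subrKA (p x)) (le_trans (ler_normD _ _))// [leRHS]splitr.
  rewrite lerD//; last exact: ltW.
  by rewrite distrC ltW.
move=> /filterI /(_ (nbhs_right_gt 0)) /filter_ex[delta [Cd d0]].
by exists delta => // x y Cx; exact: Cd.
Qed.

Section measurable_tuple.
Context (R : realType) (d : nat).
Local Notation RT := (measurableTypeR R).

Lemma measurable_floor_tuple (c : R) :
  measurable_fun setT
    (fun t : d.-tuple RT => floor_Rd (c *: (\row_i tnth t i : 'rV[R]_d))).
Proof.
apply: measurable_fun_Zd => z.
have -> : (fun t : d.-tuple RT => floor_Rd (c *: (\row_i tnth t i : 'rV[R]_d)))
    @^-1` [set z] = \bigcap_(i in [set: 'I_d])
     ((fun t : d.-tuple RT => tnth t i) @^-1`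
        [set x : R | Num.floor (c * x) = Zd_coord z i]).
  apply/seteqP; split=> [t /= tz i _ /=|t tz].
    by rewrite -tz /Zd_coord !mxE.
  by apply/matrixP => i j; rewrite ord1 !mxE; exact: tz.
apply: fin_bigcap_measurable; first exact: finite_finset.
move=> i _; rewrite -[X in measurable X]setTI.
apply: (@measurable_tnth _ RT d i) => //.
have -> : [set x : R | Num.floor (c * x) = Zd_coord z i] =
    ( *%R c) @^-1` `[(Zd_coord z i)%:~R, (Zd_coord z i + 1)%:~R[%classic.
  apply/seteqP; split=> x /=; rewrite in_itv /= => h.
    by rewrite -h floor_itv.
  exact: floor_def.
rewrite -[X in measurable X]setTI; exact: measurable_funM.
Qed.

(** A continuous function on row vectors is the pointwise limit of its values at
    points rounded to multiples of [1 / (n + 1)], and these depend on countably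
    many measurable cells. *)
Lemma measurable_continuous_tuple (p : 'rV[R]_d -> R) : continuous p ->
  measurable_fun setT (fun t : d.-tuple RT => p (\row_i tnth t i)).
Proof.
move=> cp.
pose h (n : nat) (t : d.-tuple RT) : R := p (n.+1%:R^-1 *:
   Zd_to_Rd R (floor_Rd (n.+1%:R *: (\row_i tnth t i : 'rV[R]_d)))).
apply: (@measurable_fun_cvg _ _ _ _ h) => [n|t _].
  have mq : measurable_fun setT
    (fun z : Zd d => p (n.+1%:R^-1 *: Zd_to_Rd R z)) by [].
  exact: (measurableT_comp mq (measurable_floor_tuple n.+1%:R)).
apply: continuous_cvg; first exact: cp.
apply/cvgrPdist_le => e e0; near=> n.
apply: rV_norm_le => [|i]; first exact: ltW.
rewrite !mxE; set x := tnth t i : R.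
have n0 : (0 : R) < n.+1%:R by [].
have -> : x - n.+1%:R^-1 * (Num.floor (n.+1%:R * x))%:~R =
   n.+1%:R^-1 * (n.+1%:R * x - (Num.floor (n.+1%:R * x))%:~R).
  by field; rewrite addrC natr1; exact: lt0r_neq0.
have /andP[f1 f2] := floor_itv (n.+1%:R * x).
rewrite ger0_norm; last by rewrite mulr_ge0 ?invr_ge0 ?subr_ge0 ?(ltW n0).
rewrite mulrC ler_pdivrMr//.
apply: (@le_trans _ _ 1).
  by rewrite lerBlDl; move: f2; rewrite intrD => /ltW.
rewrite -ler_pdivrMl// mulr1 (@le_trans _ _ n%:R)//; last by rewrite ler_nat.
near: n; exact: nbhs_infty_ger.
Unshelve. all: by end_near. Qed.

End measurable_tuple.

(** * Riemann sums of a continuous density *)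

Section riemann_sums.
Context (R : realType) (d : nat).
Local Notation RT := (measurableTypeR R).
Local Notation leb := (lebesgue_tuple R d).

Definition half_open_box (a b : 'I_d -> R) : set (d.-tuple RT) :=
  [set t | forall i, a i < tnth t i <= b i].

Lemma measurable_half_open_box a b : measurable (half_open_box a b).
Proof.
rewrite (_ : half_open_box a b = \bigcap_(i in [set: 'I_d])
   ((fun t : d.-tuple RT => tnth t i) @^-1` `]a i, b i])).
  apply: fin_bigcap_measurable; first exact: finite_finset.
  move=> i _; rewrite -[X in measurable X]setTI.
  exact: (@measurable_tnth _ R d i).
apply/seteqP; split=> [t Bt i _|t Bt i] /=; rewrite ?in_itv/=; first exact: Bt.
by have /= := Bt i I; rewrite in_itv.
Qed.

(** The lower corners of the [(2 m) ^ d] boxes of side [delta] which tile the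
    box [(- m * delta, m * delta] ^ d]. *)
Definition grid_corner (delta : R) (m : nat) (i : {ffun 'I_d -> 'I_(2 * m)}) :
  'rV[R]_d := \row_k (delta * ((i k)%:R - m%:R)).

(** The box of side [delta] with lower corner [grid_corner delta i]. *)
Definition grid_box (delta : R) (m : nat) (i : {ffun 'I_d -> 'I_(2 * m)}) :=
  half_open_box (grid_corner delta i ord0)
    (fun k => grid_corner delta i ord0 k + delta).

Lemma lt_le_succ_ord (n : nat) (u : R) : 0 < u <= n%:R ->
  exists j : 'I_n, j%:R < u <= j.+1%:R.
Proof.
move=> /andP[u0 un]; have /andP[c1 c2] := ceil_itv u.
have c0 : (0 < Num.ceil u)%R by rewrite -(ltr_int R) (lt_le_trans u0).
have cn : (Num.ceil u <= n%:Z)%R by rewrite ceil_le_int.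
case: (Num.ceil u) c0 cn c1 c2 => // -[//|k] _ kn c1 c2.
have kn' : (k < n)%N by lia.
exists (Ordinal kn') => /=; rewrite c2 andbT; move: c1.
by rewrite (_ : (k.+1%:Z - 1)%R = k%:Z)//; lia.
Qed.

Lemma grid_cover (delta : R) (m : nat) : 0 < delta ->
  half_open_box (fun=> - (delta * m%:R)) (fun=> delta * m%:R) =
  \big[setU/set0]_(i <- index_enum {ffun 'I_d -> 'I_(2 * m)}) grid_box delta i.
Proof.
move=> d0; rewrite -bigcup_seq; apply/seteqP; split=> [t tm|t [i _ ti] k].
  have /choice[j jP] : forall k, exists j : 'I_(2 * m),
      j%:R < tnth t k / delta + m%:R <= j.+1%:R.
    move=> k; apply: lt_le_succ_ord; have /andP[t1 t2] := tm k.
    rewrite -ltrBlDr sub0r ltr_pdivlMr// mulNr mulrC t1/= natrM -lerBrDr.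
    by rewrite ler_pdivrMr// (le_trans t2)// mulrC ler_pM2r//; lra.
  exists [ffun k => j k]; first by rewrite /= mem_index_enum.
  move=> k; rewrite !mxE ffunE; have := jP k; rewrite -natr1.
  set u := tnth t k : R; move: (j k)%:R => x.
  have -> : u / delta + m%:R = (u + delta * m%:R) / delta.
    by field; exact: lt0r_neq0.
  rewrite ltr_pdivlMr// ler_pdivrMr// => /andP[h1 h2].
  by apply/andP; split; lra.
have /andP[] := ti k; rewrite !mxE.
have : (i k)%:R + 1 <= (2 * m)%:R :> R by rewrite natr1 ler_nat.
rewrite natrM => im h1 h2; apply/andP; split.
  apply: le_lt_trans h1; rewrite mulrBr -[leLHS]add0r lerD2r.
  by rewrite mulr_ge0 ?(ltW d0).
apply: le_trans h2 _; rewrite -[X in _ + X]mulr1 -mulrDr ler_pM2l//; lra.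
Qed.

Lemma grid_box_inj (delta : R) (m : nat) (i j : {ffun 'I_d -> 'I_(2 * m)}) t :
  0 < delta -> grid_box delta i t -> grid_box delta j t -> i = j.
Proof.
move=> d0 it jt; apply/ffunP => k; apply: val_inj => /=.
have := it k; have := jt k; rewrite !mxE => /andP[j1 j2] /andP[i1 i2].
have ij : (i k < (j k).+1)%N.
  rewrite -(ltr_nat R) -natr1 -(ltr_pM2l d0) mulrDr mulr1.
  have := lt_le_trans i1 j2; rewrite !mulrBr; lra.
have ji : (j k < (i k).+1)%N.
  rewrite -(ltr_nat R) -natr1 -(ltr_pM2l d0) mulrDr mulr1.
  have := lt_le_trans j1 i2; rewrite !mulrBr; lra.
lia.
Qed.

Lemma lebesgue_grid_box (delta : R) (m : nat) (i : {ffun 'I_d -> 'I_(2 * m)}) :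
  0 < delta -> leb (grid_box delta i) = (delta ^+ d)%:E.
Proof.
move=> d0; rewrite /grid_box /half_open_box lebesgue_tuple_box; last first.
  by move=> k; rewrite lerDl ltW.
congr EFin; under eq_bigr do rewrite addrC addKr.
by rewrite prodr_const card_ord.
Qed.

Variable p : 'rV[R]_d -> R.
Hypotheses (cp : continuous p) (p0 : forall z, 0 <= p z).
Let P (t : d.-tuple RT) : R := p (\row_i tnth t i).
Hypothesis p1 : (\int[leb]_t (P t)%:E = 1)%E.

Let mP : measurable_fun setT P.
Proof. exact: measurable_continuous_tuple. Qed.

Let iP : leb.-integrable setT (EFin \o P).
Proof.
apply/integrableP; split; first exact/measurable_EFinP.
under eq_integral => t _ do rewrite /= ger0_norm ?p0//.
by rewrite p1 ltry.
Qed.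

(** Most of the mass of the density lies in a large box. *)
Lemma box_mass (eps : R) : 0 < eps ->
  exists2 N : nat, (0 < N)%N &
  1 - eps <= \int[leb]_(t in half_open_box (fun=> - N%:R) (fun=> N%:R)) P t
    <= 1.
Proof.
move=> eps0.
pose B (n : nat) := half_open_box (fun=> - n%:R) (fun=> n%:R).
have mB n : measurable (B n) by exact: measurable_half_open_box.
have le1 n : \int[leb]_(t in B n) P t <= 1.
  rewrite /Rintegral -lee_fin fineK; last first.
    by apply: integrable_fin_num => //; apply: integrableS iP.
  rewrite -p1; apply: ge0_subset_integral => //; first exact/measurable_EFinP.
  by move=> t _; rewrite lee_fin p0.
have cB : (\int[leb]_t ((EFin \o P) \_ (B n)) t)%E @[n --> \oo] -->
    (\int[leb]_t (EFin \o P) t)%E.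
  apply: (@dominated_cvg _ _ _ _ _ measurableT _ _ (EFin \o P)) => //.
  - move=> n; apply/(measurable_restrictT _ (mB n)).
    exact/measurable_funTS/measurable_EFinP.
  - move=> t _; apply: cvg_near_cst.
    near=> n; rewrite patchT// inE /B /half_open_box /= => i.
    have : `|(\row_j tnth t j : 'rV[R]_d) ord0 i| < n%:R.
      apply: le_lt_trans (rV_norm_ge _ _) _; near: n; exact: nbhs_infty_gtr.
    by rewrite mxE ltr_norml => /andP[-> /ltW].
  - move=> n t _; rewrite /patch; case: ifPn => _ /=.
      by rewrite ger0_norm ?p0.
    by rewrite normr0 lee_fin p0.
have [n n0 Hn] : exists2 n, (0 < n)%N & 1 - eps <= \int[leb]_(t in B n) P t.
  move: cB; rewrite p1 => /fine_cvgP[_ /cvgrPdist_le /(_ _ eps0)] /= h.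
  case: h => n _ /(_ n.+1 (leqnSn n)) /= hn.
  exists n.+1 => //; move: hn.
  rewrite ler_norml -integral_mkcond -/(Rintegral _ _ _).
  by move=> /andP[_]; lra.
by exists n; rewrite ?Hn ?le1.
Unshelve. all: by end_near. Qed.

(** Some Riemann sum of the density is within [eps] of 1, and the oscillations
    of the density at twice the scale of the mesh, weighted by the volume of a
    box and summed over all boxes, amount to at most [eps]. *)
Lemma riemann_sum_density (eps : R) : 0 < eps ->
  exists m : nat, (0 < m)%N /\ exists2 delta : R, 0 < delta &
    `|\sum_(i : {ffun 'I_d -> 'I_(2 * m)}) delta ^+ d * p (grid_corner delta i)
      - 1| <= eps /\
    forall (i : {ffun 'I_d -> 'I_(2 * m)}) z,
      `|z - grid_corner delta i| <= 2 * delta ->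
      delta ^+ d * `|p z - p (grid_corner delta i)| <=
        eps / #|{ffun 'I_d -> 'I_(2 * m)}|%:R.
Proof.
move=> eps0; have e20 : 0 < eps / 2 by lra.
have [N N0 /andP[N1 N2]] := box_mass e20.
have N0' : 0 < N%:R :> R by rewrite ltr0n.
(* [eta] is the admissible oscillation of [p] on a box: summed over the box of
   side [2 N] it amounts to [eps / 2]. *)
pose eta := eps / 2 / (2 * N%:R) ^+ d.
have eta0 : 0 < eta by rewrite divr_gt0// exprn_gt0// mulr_gt0.
have [delta0 delta00 unif] := compact_uniform_continuity
  (@closed_ball_compact R d N%:R) cp eta0.
(* The mesh is [1 / q] with [q] an integer, so that the grid fits [N] exactly;
   [q] is large enough for twice the mesh to be below [delta0]. *)
pose q := (Num.truncn (2 / delta0)).+1; pose m := (N * q)%N.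
have q0 : 0 < q%:R :> R by rewrite ltr0n.
pose delta : R := q%:R^-1.
have d0 : 0 < delta by rewrite invr_gt0.
have dm : delta * m%:R = N%:R by rewrite /delta natrM; field; exact: lt0r_neq0.
have dq : 2 * delta <= delta0.
  rewrite /delta ler_pdivrMr// mulrC -ler_pdivrMr//; apply: ltW.
  exact: truncnS_gt.
have cgrid (i : {ffun 'I_d -> 'I_(2 * m)}) : `|grid_corner delta i| <= N%:R.
  apply: rV_norm_le; first exact: ltW.
  move=> k; rewrite mxE -dm normrM (gtr0_norm d0) ler_pM2l//.
  have : (i k)%:R <= (2 * m)%:R :> R by rewrite ler_nat ltnW.
  by rewrite natrM ler_norml; have := ler0n R (i k); lra.
have cardE : delta ^+ d * eta = eps / 2 / #|{ffun 'I_d -> 'I_(2 * m)}|%:R.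
  rewrite card_ffun !card_ord natrX natrM /eta -dm.
  have -> : (2 * (delta * m%:R)) = delta * (2 * m%:R) by ring.
  rewrite exprMn invfM.
  have : delta ^+ d != 0 by rewrite expf_neq0// lt0r_neq0.
  set D := delta ^+ d; set E := (_ ^+ d)^-1 => D0.
  by field.
have osc (i : {ffun 'I_d -> 'I_(2 * m)}) z :
    `|z - grid_corner delta i| <= 2 * delta ->
    `|p z - p (grid_corner delta i)| <= eta.
  move=> zi; rewrite distrC; apply: unif => //; first exact: cgrid.
  by rewrite distrC (le_trans zi).
have card0 : 0 < #|{ffun 'I_d -> 'I_(2 * m)}|%:R :> R.
  by rewrite ltr0n card_ffun !card_ord expn_gt0 !muln_gt0 N0.
exists m; split; first by rewrite muln_gt0 N0.
exists delta => //; split; last first.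
  move=> i z zi; apply: (@le_trans _ _ (delta ^+ d * eta)).
    by rewrite ler_pM2l ?exprn_gt0//; exact: osc.
  by rewrite cardE ler_pM2r ?invr_gt0//; lra.
have mbox (i : {ffun 'I_d -> 'I_(2 * m)}) : measurable (grid_box delta i).
  exact: measurable_half_open_box.
have boxE (i : {ffun 'I_d -> 'I_(2 * m)}) :
    `|\int[leb]_(t in grid_box delta i) P t -
      delta ^+ d * p (grid_corner delta i)| <= delta ^+ d * eta.
  have icst c : leb.-integrable (grid_box delta i) (EFin \o cst c).
    apply: measurable_bounded_integrable => //.
      by have /= -> := lebesgue_grid_box i d0; rewrite ltry.
    by exists `|c|; split; [exact: num_real|move=> x cx y _ /=; exact: ltW].
  have vol c : \int[leb]_(t in grid_box delta i) (cst c t) = delta ^+ d * c.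
    rewrite Rintegral_cst//; have /= -> := lebesgue_grid_box i d0.
    by rewrite mulrC.
  have Pi t : grid_box delta i t -> `|P t - p (grid_corner delta i)| <= eta.
    move=> ti; apply: osc; apply: rV_norm_le; first by rewrite mulr_ge0// ltW.
    move=> k; have := ti k; rewrite !mxE => /andP[t1 t2].
    by rewrite ler_norml; apply/andP; split; lra.
  rewrite -(vol eta) -(vol (p _)) -RintegralB//; last exact: integrableS iP.
  have iB : leb.-integrable (grid_box delta i)
      (EFin \o (fun t => P t - p (grid_corner delta i))).
    by apply: eq_integrable (integrableB (mbox i)
      (integrableS measurableT (mbox i) _ iP) (icst (p (grid_corner delta i)))).
  apply: le_trans (le_normr_Rintegral _ iB) _ => //.
  by apply: le_Rintegral => //; exact: (integrable_norm iB).
have -> : \sum_(i : {ffun 'I_d -> 'I_(2 * m)})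
      delta ^+ d * p (grid_corner delta i) =
    \int[leb]_(t in half_open_box (fun=> - N%:R) (fun=> N%:R)) P t -
    \sum_(i : {ffun 'I_d -> 'I_(2 * m)})
      (\int[leb]_(t in grid_box delta i) P t -
      delta ^+ d * p (grid_corner delta i)).
  rewrite sumrB opprB addrC -addrA [X in _ + X](_ : _ = 0) ?addr0//.
  rewrite -dm (grid_cover _ d0) /Rintegral ge0_integral_bigsetU//.
  - rewrite sum_fine ?addNr//.
    by move=> i _; apply: integrable_fin_num => //; exact: integrableS iP.
  - exact: index_enum_uniq.
  - apply/trivIsetP => i j _ _ ij; apply/seteqP; split=> // t [ti tj].
    by move: ij; rewrite (grid_box_inj d0 ti tj) eqxx.
  - exact/measurable_funTS/measurable_EFinP.
  - by move=> t _; rewrite lee_fin p0.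
set S := \sum_i _; have : `|S| <= eps / 2.
  apply: le_trans (ler_norm_sum _ _ _) _.
  apply: le_trans (ler_sum _ (fun i _ => boxE i)) _.
  rewrite sumr_const -[leLHS]mulr_natr cardE divfK//.
  exact: lt0r_neq0.
by rewrite !ler_norml; lra.
Qed.

End riemann_sums.

(** * The local limit theorem on blocks *)

Section block_limit_theorem.
Context (disp : measure_display) (R : realType) (d : nat).
Context (M : borelMetricType disp R) (nu : probability M R).
Variables (f : M -> M) (tau : M -> Zd d).

(** The correlation of [g] and [h \o f^n] on the event that the [n]-th Birkhoff
    sum of [tau] takes the value [w]. *)
Definition correlation (n : nat) (g h : M -> R) (w : Zd d) : R :=
  \int[nu]_y (g y * h (iter n f y) *
    \1_[set y' | birkhoff_sum f tau n y' = w] y).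

(** The displacement from the base point to the center of the [i]-th block, when
    [(2 m) ^ d] cubic blocks of side [W] tile the cube of side [2 m W]. *)
Definition block_offset (W m : nat) (i : {ffun 'I_d -> 'I_(2 * m)}) : Zd d :=
  (\row_k (W%:Z * ((i k)%:Z - m%:Z) + W./2%:Z - 1) : 'rV[int]_d).

Lemma Zd_coord_block (W m : nat) (i : {ffun 'I_d -> 'I_(2 * m)})
    (k : {ffun 'I_d -> 'I_W}) l :
  Zd_coord (cube_point (block_offset W i) k) l =
  W%:Z * ((i l)%:Z - m%:Z) + (k l)%:Z.
Proof. by rewrite /Zd_coord !mxE /Zd_coord !mxE; ring. Qed.

Lemma block_point_inj (z0 : Zd d) (W m : nat) :
  injective (fun ik : {ffun 'I_d -> 'I_(2 * m)} * {ffun 'I_d -> 'I_W} =>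
    cube_point (z0 + block_offset W ik.1) ik.2).
Proof.
move=> [i k] [i' k'] /=; rewrite !cube_pointD => /addrI /matrixP E.
have H l : (i l * W + k l = i' l * W + k' l)%N.
  have := E ord0 l; rewrite -!/(Zd_coord _ _) !Zd_coord_block => e.
  apply/eqP; rewrite -eqz_nat !PoszD !PoszM; apply/eqP.
  by move: e; rewrite !mulrBr ![_ * W%:Z]mulrC; lia.
have [ii kk] : (forall l, i l = i' l :> nat) /\ (forall l, k l = k' l :> nat).
  split=> l; have W0 : (0 < W)%N by apply: leq_ltn_trans (ltn_ord (k l)).
    by have := congr1 (divn^~ W) (H l); rewrite !divnMDl// !divn_small// !addn0.
  by have := congr1 (modn^~ W) (H l); rewrite !modnMDl !modn_small.
by congr (_, _); apply/ffunP => l; apply: val_inj; [exact: ii|exact: kk].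
Qed.

Lemma floor_Rd_scale (l : R) (u : Zd d) : l != 0 ->
  floor_Rd (l *: (l^-1 *: Zd_to_Rd R u)) = u.
Proof.
move=> l0; rewrite scalerA divff// scale1r.
by apply/matrixP => i j; rewrite !mxE intrKfloor.
Qed.

Lemma scaled_floor_cvg0 (L : nat -> R) (D : nat -> 'rV[R]_d) :
  (forall n, 0 < L n) -> L @ \oo --> +oo ->
  (fun n => (L n)^-1 *: (Zd_to_Rd R (floor_Rd (D n)) - D n)) @ \oo
    --> (0 : 'rV[R]_d).
Proof.
move=> L0 Loo; apply/cvgrPdist_le => e e0; near=> n.
rewrite sub0r normrN normrZ; have l0 := L0 n.
rewrite gtr0_norm ?invr_gt0// ler_pdivrMl//.
apply: (@le_trans _ _ 1).
  apply: rV_norm_le => // i; rewrite !mxE.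
  have /andP[f1 f2] := floor_itv (D n ord0 i).
  rewrite distrC ger0_norm ?subr_ge0// lerBlDl; move: f2; rewrite intrD.
  exact: ltW.
rewrite mulrC -ler_pdivrMl// mulr1.
by near: n; move/cvgryPge : Loo; apply.
Unshelve. all: by end_near. Qed.

(** The local limit theorem on a fixed finite number of cubic blocks: up to
    [eps], the law of the Birkhoff sum is a mixture, with weights [c i], of the
    uniform laws on the disjoint cubes of center [ctr n i] and size [W n], and
    conditionally on each point of these cubes [g] and [h \o f^n] are
    asymptotically independent. The cubes have integer side
    [W n = floor (delta * L n)], where [delta] is the mesh of a Riemann sum of
    the limit density. *)
Lemma block_LLT (L : nat -> R) (eps : R) :
  shifted_mixing_LLT nu f tau L -> 0 < eps ->
  exists (I : finType) (c : I -> R) (W : nat -> nat) (ctr : nat -> I -> Zd d),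
  [/\ (forall i, 0 <= c i) /\ `|\sum_i c i - 1| <= eps,
      forall A : nat, \forall n \near \oo, (A < W n)%N,
      forall n, injective (fun ik : I * {ffun 'I_d -> 'I_(W n)} =>
        cube_point (ctr n ik.1) ik.2) &
      forall g h : M -> R, continuous g -> continuous h ->
        \forall n \near \oo, forall i (k : {ffun 'I_d -> 'I_(W n)}),
        `|(W n)%:R ^+ d * correlation n g h (cube_point (ctr n i) k) -
          (\int[nu]_y g y) * (\int[nu]_y h y) * c i| <=
        eps * (1 + `|(\int[nu]_y g y) * (\int[nu]_y h y)|) / #|I|%:R].
Proof.
move=> [L0 Loo [D [p [cp p0 p1 lltP]]]] eps0.
have [m [m0 [delta d0 [sum1 osc]]]] := riemann_sum_density cp p0 p1 eps0.
pose I := {ffun 'I_d -> 'I_(2 * m)}.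
pose W n := Num.truncn (delta * L n).
have WP n : (W n)%:R <= delta * L n < (W n).+1%:R.
  by apply: truncn_itv; rewrite mulr_ge0 ?ltW.
pose z0 n := floor_Rd (D n).
exists I, (fun i => delta ^+ d * p (grid_corner delta i)), W,
  (fun n i => z0 n + block_offset (W n) i).
have I0 : 0 < #|{: I}|%:R :> R.
  by rewrite ltr0n card_ffun !card_ord expn_gt0 !muln_gt0 m0.
have dd0 : 0 < delta ^+ d by rewrite exprn_gt0.
split=> [|A|n|].
- by split=> // i; rewrite mulr_ge0// ltW.
- near=> n; have /andP[_ h] := WP n.
  rewrite -ltnS -(ltr_nat R); apply: le_lt_trans h.
  rewrite -ler_pdivrMl//.
  by near: n; move/cvgryPge : Loo; apply.
- exact: block_point_inj.
move=> g h cg ch; set G := _ * _ in lltP *.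
(* [Pmax] bounds the density at all the points considered below. *)
pose Pmax :=
  \sum_(i : I) p (grid_corner delta i) + eps / #|{: I}|%:R / delta ^+ d.
(* The error has three sources: the local limit theorem and the replacement of
   [delta * L n] by the integer [W n], which cost [e2] each, and the oscillation
   of the density over a block. *)
pose e2 := eps / #|{: I}|%:R / 2.
have e20 : 0 < e2 by rewrite /e2 !divr_gt0.
(* All the points of the blocks, rescaled by [L n], have norm below [K]. *)
pose K := delta * (m%:R + 2) + 1.
have K0 : 0 < K by rewrite ltr_wpDl// mulr_ge0 ?ltW//; rewrite ltr_wpDl.
have rcvg : (fun n => ((W n)%:R / L n) ^+ d * (Pmax * `|G|)) @ \oo -->
    delta ^+ d * (Pmax * `|G|).
  apply: cvgMl.
  apply: (@continuous_cvg _ _ _ _ _ _ (fun x : R => x ^+ d)).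
    exact: exprn_continuous.
  apply/cvgrPdist_le => e e0; near=> n; have /andP[w1 w2] := WP n.
  have l0 := L0 n.
  rewrite ger0_norm ?subr_ge0 ?ler_pdivrMr//.
  rewrite -[delta](mulfK (lt0r_neq0 l0)) -mulrBl ler_pdivrMr//.
  apply: (@le_trans _ _ 1); first by rewrite -natr1 in w2; lra.
  rewrite -ler_pdivrMl// mulr1.
  by near: n; move/cvgryPge : Loo; apply.
have lltn : \forall n \near \oo, forall z : 'rV[R]_d, `|z| < K ->
   `|L n ^+ d * correlation n g h (z0 n + floor_Rd (L n *: z)) - G * p z| <=
   e2 / delta ^+ d.
  have /fine_cvgP[fin /cvgrPdist_le /(_ (e2 / delta ^+ d))] :=
    lltP g h cg ch z0 (scaled_floor_cvg0 D L0 Loo) K K0.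
  rewrite divr_gt0// => /(_ isT) small.
  near=> n => z zK.
  pose sup := ereal_sup [set `| L n ^+ d *
     correlation n g h (z0 n + floor_Rd (L n *: z)) - G * p z |%:E |
     z in [set z : 'rV[R]_d | `|z| < K]].
  have finn : sup \is a fin_num by rewrite /sup; near: n; exact: fin.
  have smalln : `|0 - fine sup| <= e2 / delta ^+ d.
    by rewrite /sup; near: n; exact: small.
  rewrite sub0r normrN in smalln.
  apply: le_trans smalln; apply: le_trans (ler_norm _).
  rewrite -lee_fin fineK//; apply: ereal_sup_ubound => /=.
  by exists z.
near=> n => i k.
have l0 := L0 n; have /andP[w1 w2] := WP n.
set w := cube_point _ k.
pose u := cube_point (block_offset (W n) i) k.
pose z : 'rV[R]_d := (L n)^-1 *: Zd_to_Rd R u.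
have wE : w = z0 n + floor_Rd (L n *: z).
  by rewrite /z floor_Rd_scale ?lt0r_neq0// /w cube_pointD.
have Lm : m%:R / delta <= L n by near: n; move/cvgryPge : Loo; apply.
have ia l : `|(i l)%:R - m%:R| <= m%:R :> R.
  have : (i l)%:R <= (2 * m)%:R :> R by rewrite ler_nat ltnW.
  by rewrite natrM ler_norml; have := ler0n R (i l); lra.
have zi : `|z - grid_corner delta i| <= 2 * delta.
  apply: rV_norm_le => [|l]; first by rewrite mulr_ge0// ltW.
  have -> : (z - grid_corner delta i) ord0 l = (L n)^-1 *
      (((W n)%:R - delta * L n) * ((i l)%:R - m%:R) + (k l)%:R).
    have zE : z ord0 l = (L n)^-1 * (Zd_coord u l)%:~R.
      by rewrite [LHS]mxE [X in _ * X = _]mxE.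
    have -> : (z - grid_corner delta i) ord0 l =
        z ord0 l - delta * ((i l)%:R - m%:R).
      rewrite [LHS]mxE; congr (_ + _); rewrite [LHS]mxE; congr (- _).
      by rewrite mxE.
    rewrite zE Zd_coord_block.
    rewrite intrD intrM intrB -!pmulrn; field; exact: lt0r_neq0.
  rewrite normrM gtr0_norm ?invr_gt0// ler_pdivrMl//.
  apply: le_trans (ler_normD _ _) _; rewrite normrM.
  have k1 : (k l)%:R <= (W n)%:R :> R by rewrite ler_nat ltnW.
  have Lm' : m%:R <= delta * L n by rewrite mulrC -ler_pdivrMr.
  have W1 : `|(W n)%:R - delta * L n| <= 1.
    by rewrite ler_norml -natr1 in w2 *; apply/andP; split; lra.
  have := ler_pM (normr_ge0 _) (normr_ge0 _) W1 (ia l); rewrite mul1r.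
  rewrite (ger0_norm (ler0n _ (k l))); lra.
have zK : `|z| < K.
  rewrite -(subrK (grid_corner delta i) z).
  apply: le_lt_trans (ler_normD _ _) _.
  have : `|grid_corner delta i| <= delta * m%:R.
    apply: rV_norm_le => [|l]; first by rewrite mulr_ge0// ltW.
    by rewrite mxE normrM gtr0_norm// ler_pM2l.
  by rewrite /K; lra.
have h1 : `|L n ^+ d * correlation n g h w - G * p z| <= e2 / delta ^+ d.
  rewrite wE; move: z zK {zi wE}; near: n; exact: lltn.
have h2 : `|delta ^+ d * (Pmax * `|G|) -
    ((W n)%:R / L n) ^+ d * (Pmax * `|G|)| <= e2.
  by near: n; move/cvgrPdist_le : rcvg; exact.
have h3 := osc i z zi.
set pi := p (grid_corner delta i) in h3 *.
set r := ((W n)%:R / L n) ^+ d in h2.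
have r0 : 0 <= r by rewrite exprn_ge0// divr_ge0// ltW.
have rd : r <= delta ^+ d.
  by rewrite lerXn2r// ?nnegrE ?divr_ge0 ?(ltW l0) ?(ltW d0)// ler_pdivrMr.
have pz : p z <= Pmax.
  have pi1 : pi <= \sum_(i : I) p (grid_corner delta i).
    by rewrite (bigD1 i)//= lerDl sumr_ge0.
  have : `|p z - pi| <= eps / #|{: I}|%:R / delta ^+ d.
    by rewrite ler_pdivlMr// mulrC.
  by rewrite ler_norml /Pmax => /andP[_]; lra.
have -> : (W n)%:R ^+ d * correlation n g h w =
    r * (L n ^+ d * correlation n g h w).
  rewrite mulrA /r -exprMn divfK//; exact: lt0r_neq0.
set q := L n ^+ d * _ in h1 *.
have -> : r * q - G * (delta ^+ d * pi) =
    r * (q - G * p z) - G * ((delta ^+ d - r) * p z)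
    + G * (delta ^+ d * (p z - pi)) by ring.
have -> : eps * (1 + `|G|) / #|{: I}|%:R = e2 + e2 + `|G| * (eps / #|{: I}|%:R).
  by rewrite /e2; field; exact: lt0r_neq0.
apply: le_trans (ler_normD _ _) _; apply: lerD; last first.
  by rewrite normrM ler_wpM2l// normrM (gtr0_norm dd0).
apply: le_trans (ler_normB _ _) _; apply: lerD.
  rewrite normrM ger0_norm//.
  have := ler_pM r0 (normr_ge0 _) rd h1.
  by rewrite [X in _ <= X -> _]mulrC divfK// lt0r_neq0.
apply: le_trans h2; rewrite -mulrBl [leRHS]normrM normrM mulrC.
have dr : 0 <= delta ^+ d - r by rewrite subr_ge0.
rewrite normrM (ger0_norm dr) (ger0_norm (p0 z)) -mulrA ler_wpM2l//.
by rewrite [leRHS]normrM normr_id ler_wpM2r// (le_trans pz)// ler_norm.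
Unshelve. all: by end_near. Qed.

End block_limit_theorem.

(** * Total boundedness of the fibers *)

Lemma bounded_funP (T : Type) (R : realType) (F : T -> R) : bounded_fun F ->
  exists2 B, 0 < B & forall x, `|F x| <= B.
Proof.
move=> [B [_ HB]]; exists (`|B| + 1); first by rewrite ltr_wpDl.
move=> x; apply: (HB (`|B| + 1)) => //.
by rewrite (le_lt_trans (ler_norm B))// ltrDl.
Qed.

Section observables.
Context (disp : measure_display) (R : realType) (d : nat).
Context (M : borelMetricType disp R).
Hypothesis compM : compact [set: M].

Lemma compact_continuous_bounded (g : M -> R) : continuous g ->
  exists2 B, 0 < B & forall y, `|g y| <= B.
Proof.
move=> cg; apply: bounded_funP.
have : compact (g @` setT).
  by apply: continuous_compact => //; exact: continuous_subspaceT.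
move=> /compact_bounded [B [Br HB]]; exists B; split=> // x Bx y _.
by apply: HB => //; exists y.
Qed.

Lemma compact_finite_net (delta : R) : 0 < delta ->
  exists s : seq M, forall y, exists2 y', y' \in s & ball y' delta y.
Proof.
move=> d0; have := compM; rewrite compact_cover.
move=> /(_ M setT (fun y => (ball y delta)^°)) [].
- by move=> y _; exact: open_interior.
- by move=> y _; exists y => //; apply: nbhsx_ballx.
- move=> D _ cD; exists (finmap.enum_fset D) => y.
  by have [y' /= yD /interior_subset yy'] := cD y I; exists y'.
Qed.

Variable Phi : M * Zd d -> R.
Hypothesis uPhi : unif_continuous Phi.

Lemma unif_continuous_fibers (eps : R) : 0 < eps ->
  exists2 delta, 0 < delta & forall z y y', ball y delta y' ->
    `|Phi (y, z) - Phi (y', z)| <= eps.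
Proof.
move=> e0; have /unif_continuousP/(_ eps e0) [delta d0 H] := uPhi.
exists delta => // z y y' yy'; have := H ((y, z), (y', z)) => /=.
rewrite -ball_normE /= => h; apply/ltW/h; split => //=; exact: ballxx.
Qed.

Lemma continuous_fiber z : continuous (fun y => Phi (y, z)).
Proof.
move=> y; apply/cvgrPdist_le => e e0.
have [delta d0 H] := unif_continuous_fibers e0.
by near=> y'; apply: H; near: y'; exact: nbhsx_ballx.
Unshelve. all: by end_near. Qed.

Lemma measurable_observable : measurable_fun setT Phi.
Proof.
apply: measurable_fun_slices => z; apply: borel_continuous_measurable.
exact: continuous_fiber.
Qed.

(** The fibers of a bounded uniformly continuous observable form a totally
    bounded family: each of them is coded by its values at the points of a
    finite net of [M], shifted by a bound [B] to make them nonnegative and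
    rounded down to a multiple of [eps / 4]. *)
Lemma fibers_totally_bounded (eps : R) : bounded_fun Phi -> 0 < eps ->
  exists s : seq (Zd d), forall z, exists2 z', z' \in s &
    forall y, `|Phi (y, z) - Phi (y, z')| <= eps.
Proof.
move=> /bounded_funP[B B0 PhiB] eps0.
have e40 : 0 < eps / 4 by rewrite divr_gt0.
have [delta d0 unif] := unif_continuous_fibers e40.
have [net netP] := compact_finite_net d0.
pose code z y := Num.truncn ((Phi (y, z) + B) / (eps / 4)).
pose N := (Num.truncn (2 * B / (eps / 4))).+1.
have code_ge0 z y : 0 <= (Phi (y, z) + B) / (eps / 4).
  rewrite divr_ge0 ?(ltW e40)//.
  by have := PhiB (y, z); rewrite ler_norml => /andP[]; lra.
have codeN z y : (code z y < N)%N.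
  rewrite ltnS; apply: le_truncn; rewrite ler_pM2r ?invr_gt0//.
  by have := PhiB (y, z); rewrite ler_norml => /andP[]; lra.
pose fcode z : {ffun seq_sub net -> 'I_N} :=
  [ffun y => Ordinal (codeN z (ssval y))].
(* One index is chosen for each code which occurs. *)
pose r (k : {ffun seq_sub net -> 'I_N}) := xget 0 [set z | fcode z = k].
exists [seq r k | k <- enum {ffun seq_sub net -> 'I_N}] => z.
exists (r (fcode z)); first by apply: map_f; rewrite mem_enum.
set z' := r _; have zz' : fcode z' = fcode z.
  by apply: (@xgetPex _ 0 [set z' | fcode z' = fcode z]); exists z.
move=> y; have [y' y'net yy'] := netP y.
have : code z' y' = code z y'.
  by have /ffunP/(_ (SeqSub y'net)) := zz'; rewrite !ffunE => -[].
rewrite /code => cc.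
have /andP[a1 a2] := truncn_itv (code_ge0 z y').
have /andP[b1 b2] := truncn_itv (code_ge0 z' y').
rewrite cc in b1 b2; move: a1 a2 b1 b2.
rewrite -[(Num.truncn _).+1%:R]natr1 !ler_pdivlMr// !ltr_pdivrMr//.
rewrite [(_ + 1) * _]mulrDl mul1r => a1 a2 b1 b2.
have := unif z _ _ yy'; have := unif z' _ _ yy'.
by rewrite !ler_norml => /andP[u1 u2] /andP[v1 v2]; apply/andP; split; lra.
Qed.

End observables.

(** * Splitting integrals by the value of the Birkhoff sum *)

Section equidistribution.
Context (disp : measure_display) (R : realType) (d : nat).
Context (M : borelMetricType disp R) (nu : probability M R).
Variables (f : M -> M) (tau : M -> Zd d).
Hypotheses (mf : measurable_fun setT f) (mtau : measurable_fun setT tau).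
Local Notation S := (birkhoff_sum f tau).
Local Notation corr := (correlation nu f tau).

Let mS n w : measurable [set y' | S n y' = w].
Proof.
rewrite -[X in measurable X]setTI.
exact: (measurable_birkhoff_sum mf mtau n measurableT (Y := [set w])).
Qed.

Let mcorr n (g h : M -> R) (w : Zd d) :
  measurable_fun setT g -> measurable_fun setT h ->
  measurable_fun setT
    (fun y => g y * h (iter n f y) * \1_[set y' | S n y' = w] y).
Proof.
move=> mg mh; apply: measurable_funM; last exact: measurable_indic.
apply: measurable_funM => //.
exact: (measurableT_comp mh (measurable_iter mf n)).
Qed.

Let indic01 n w y : \1_[set y' | S n y' = w] y = (S n y == w)%:R :> R.
Proof. by rewrite indicE; congr (nat_of_bool _)%:R; apply/asboolP/eqP. Qed.

Let icorr n (g h : M -> R) (w : Zd d) Bg Bh :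
  measurable_fun setT g -> measurable_fun setT h ->
  (forall y, `|g y| <= Bg) -> (forall y, `|h y| <= Bh) ->
  nu.-integrable setT
    (EFin \o (fun y => g y * h (iter n f y) * \1_[set y' | S n y' = w] y)).
Proof.
move=> mg mh gB hB; apply: (@bounded_integrable _ _ _ nu _ (Bg * Bh)).
  exact: mcorr.
move=> y; rewrite normrM -[leRHS]mulr1; apply: ler_pM => //.
  by rewrite normrM ler_pM.
by rewrite indic01 normr_nat; case: eqP.
Qed.

Let corr1E n w : corr n (cst 1) (cst 1) w =
  \int[nu]_y \1_[set y' | S n y' = w] y.
Proof. by apply: eq_Rintegral => y _; rewrite /= !mul1r. Qed.

Let i1 n w : nu.-integrable setT (EFin \o (\1_[set y' | S n y' = w] : M -> R)).
Proof.
apply: (@bounded_integrable _ _ _ nu _ 1); first exact: measurable_indic.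
by move=> y; rewrite indic01 normr_nat; case: eqP.
Qed.

Lemma correlation_lipschitz n (g h h' : M -> R) (w : Zd d) Bg Bh e :
  measurable_fun setT g -> measurable_fun setT h -> measurable_fun setT h' ->
  (forall y, `|g y| <= Bg) -> (forall y, `|h y| <= Bh) ->
  (forall y, `|h' y| <= Bh) -> (forall y, `|h y - h' y| <= e) ->
  `|corr n g h w - corr n g h' w| <= Bg * e * corr n (cst 1) (cst 1) w.
Proof.
move=> mg mh mh' gB hB hB' hh'.
rewrite corr1E -RintegralZl// -RintegralB//; last 2 first.
- exact: icorr gB hB.
- exact: icorr gB hB'.
have iD : nu.-integrable setT (EFin \o (fun y =>
    g y * h (iter n f y) * \1_[set y' | S n y' = w] y -
    g y * h' (iter n f y) * \1_[set y' | S n y' = w] y)).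
  by apply: eq_integrable (integrableB measurableT (icorr n w mg mh gB hB)
    (icorr n w mg mh' gB hB')).
apply: le_trans (le_normr_Rintegral _ iD) _ => //.
apply: le_Rintegral => //.
- exact: (integrable_norm iD).
- by apply: eq_integrable (integrableZl measurableT (Bg * e) (i1 n w)).
- move=> y _; rewrite -mulrBl -mulrBr normrM indic01 normr_nat.
  by rewrite ler_wpM2r// normrM ler_pM.
Qed.

Variables (I : finType) (pt : I -> Zd d).
Hypothesis pt_inj : injective pt.

Let sum_indic n y : \sum_k (\1_[set y' | S n y' = pt k] y) =
  [exists k, S n y == pt k]%:R :> R.
Proof.
case: existsP => [[k /eqP Sk]|nk].
  rewrite (bigD1 k)//= indic01 Sk eqxx big1 ?addr0// => k' k'k.
  rewrite indic01 Sk; case: eqP => // /pt_inj kk'.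
  by rewrite kk' eqxx in k'k.
rewrite big1// => k _; rewrite indic01; case: eqP => // Sk.
by case: nk; exists k; rewrite Sk.
Qed.

Let sum_corr1E n : \sum_k corr n (cst 1) (cst 1) (pt k) =
  \int[nu]_y (\sum_k \1_[set y' | S n y' = pt k] y).
Proof.
rewrite Rintegral_sum; last by move=> k; exact: i1.
by apply: eq_bigr => k _; rewrite corr1E.
Qed.

Let isum1 n : nu.-integrable setT
  (EFin \o (fun y => \sum_k \1_[set y' | S n y' = pt k] y : R)).
Proof.
apply: (@bounded_integrable _ _ _ nu _ 1).
  by apply: measurable_sum => k; exact: measurable_indic.
by move=> y; rewrite sum_indic normr_nat; case: existsP.
Qed.

Lemma sum_correlation1_le1 n : \sum_k corr n (cst 1) (cst 1) (pt k) <= 1.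
Proof.
rewrite sum_corr1E -[leRHS](prob_Rintegral_cst nu); apply: le_Rintegral => //.
  by apply: (@bounded_integrable _ _ _ nu (cst 1) 1) => // y; rewrite normr1.
by move=> y _; rewrite sum_indic; case: existsP.
Qed.

(** Splitting the integral of [Phi] along the orbit according to the value of
    the Birkhoff sum; the values outside the range of [pt] are controlled by
    their total mass. *)
Lemma orbit_integral_split n (g : M -> R) (Phi : M * Zd d -> R) z Bg B :
  measurable_fun setT g -> measurable_fun setT Phi ->
  (forall y, `|g y| <= Bg) -> (forall x, `|Phi x| <= B) ->
  `|\int[nu]_y (g y * Phi (iter n f y, z + S n y)) -
    \sum_k corr n g (fun y => Phi (y, z + pt k)) (pt k)| <=
  Bg * B * (1 - \sum_k corr n (cst 1) (cst 1) (pt k)).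
Proof.
move=> mg mPhi gB PhiB.
have mPhiz w : measurable_fun setT (fun y => Phi (y, w)).
  exact: measurable_fun_slice.
have iJ : nu.-integrable setT
    (EFin \o (fun y => g y * Phi (iter n f y, z + S n y))).
  apply: (@bounded_integrable _ _ _ nu _ (Bg * B)).
    by apply: measurable_funM => //; exact: measurable_orbit.
  by move=> y; rewrite normrM ler_pM.
have ic k : nu.-integrable setT (EFin \o (fun y =>
    g y * Phi (iter n f y, z + pt k) * \1_[set y' | S n y' = pt k] y)).
  exact: (icorr n (pt k) mg (mPhiz (z + pt k)) gB (fun y => PhiB (y, _))).
rewrite -Rintegral_sum// sum_corr1E.
have -> : 1 = \int[nu]_y (cst 1 y) :> R by rewrite prob_Rintegral_cst.
have i1' : nu.-integrable setT (EFin \o (cst 1 : M -> R)).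
  by apply: (@bounded_integrable _ _ _ nu (cst 1) 1) => // y; rewrite normr1.
have iS : nu.-integrable setT (EFin \o (fun y =>
    \sum_k g y * Phi (iter n f y, z + pt k) * \1_[set y' | S n y' = pt k] y)).
  apply: eq_integrable (integrable_sum measurableT (index_enum I)
    (P := xpredT) (fun k _ => ic k)) => //.
  by move=> y _; rewrite /= sumEFin.
rewrite -RintegralB// -RintegralB// -RintegralZl//; last first.
  exact: eq_integrable (integrableB measurableT i1' (isum1 n)).
have iD : nu.-integrable setT (EFin \o (fun y =>
    g y * Phi (iter n f y, z + S n y) -
    \sum_k g y * Phi (iter n f y, z + pt k) * \1_[set y' | S n y' = pt k] y)).
  by apply: eq_integrable (integrableB measurableT iJ iS).
apply: le_trans (le_normr_Rintegral _ iD) _ => //.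
apply: le_Rintegral => //.
- exact: (integrable_norm iD).
- by apply: eq_integrable (integrableZl measurableT (Bg * B)
    (integrableB measurableT i1' (isum1 n))).
move=> y _; rewrite sum_indic.
have -> : \sum_k g y * Phi (iter n f y, z + pt k) *
      \1_[set y' | S n y' = pt k] y =
   g y * Phi (iter n f y, z + S n y) * [exists k, S n y == pt k]%:R.
  rewrite -sum_indic mulr_sumr; apply: eq_bigr => k _.
  by rewrite indic01; case: eqP => [->//|]; rewrite !mulr0.
rewrite -[X in X - _]mulr1 -mulrBr normrM.
have b01 : 0 <= (1 : R) - [exists k, S n y == pt k]%:R.
  by case: existsP; rewrite ?subrr ?subr0.
by rewrite (ger0_norm b01) ler_wpM2r// normrM ler_pM.
Qed.

End equidistribution.

(** * Equidistribution against continuous functions *)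

Lemma near_seq (T : eqType) (P : T -> nat -> Prop) (s : seq T) :
  (forall x, \forall n \near \oo, P x n) ->
  \forall n \near \oo, forall x, x \in s -> P x n.
Proof.
move=> H; elim: s => [|x s IH]; first by near=> n.
near=> n => y; rewrite in_cons => /predU1P[->|].
  by near: n; exact: H.
by move: y; near: n; exact: IH.
Unshelve. all: by end_near. Qed.

Section equidistribution_continuous.
Context (disp : measure_display) (R : realType) (d : nat).
Context (M : borelMetricType disp R) (nu : probability M R).
Variables (f : M -> M) (tau : M -> Zd d) (L : nat -> R).
Hypothesis compM : compact [set: M].
Hypotheses (mf : measurable_fun setT f) (mtau : measurable_fun setT tau).
Hypothesis LLT : shifted_mixing_LLT nu f tau L.
Local Notation S := (birkhoff_sum f tau).
Local Notation corr := (correlation nu f tau).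
Local Notation mu := (extension_measure d nu).

Variables (Phi : M * Zd d -> R) (c : R).
Hypotheses (bPhi : bounded_fun Phi) (uPhi : unif_continuous Phi).
Hypothesis aPhi : has_average mu Phi c.

(** The core estimate, uniform in the starting level [z]. Over each block the
    correlation with the fiber of [Phi] at level [z + w] is nearly
    [nu(g) * nu(Phi(., z + w))] times a constant, and the average of
    [nu(Phi(., z + w))] over the block is close to [c] because the block is a
    large cube. *)
Lemma equidistribution_continuous (g : M -> R) (eps : R) :
  continuous g -> 0 < eps ->
  \forall n \near \oo, forall z,
    `|\int[nu]_y (g y * Phi (iter n f y, z + S n y)) - (\int[nu]_y g y) * c|
    <= eps.
Proof.
move=> cg eps0.
have [B B0 PhiB] := bounded_funP bPhi.
have [G G0 gG] := compact_continuous_bounded compM cg.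
have mPhi := measurable_observable uPhi.
have mg := borel_continuous_measurable cg.
have cPhi z : continuous (fun y => Phi (y, z)) by exact: continuous_fiber.
have mPhiz z : measurable_fun setT (fun y => Phi (y, z)).
  exact: borel_continuous_measurable.
pose A z := \int[nu]_y Phi (y, z).
have AB z : `|A z| <= B by apply: normr_Rintegral_bounded.
set ng := \int[nu]_y g y.
have ngG : `|ng| <= G by exact: normr_Rintegral_bounded.
(* [e] is the precision of every approximation below, and [C * e] bounds the
   total error; [e < 1] also ensures that there is at least one block. *)
pose C := 1 + 4 * (G * B) + 5 * G + G * `|c|.
have GB0 : 0 < G * B by exact: mulr_gt0.
have Gc0 : 0 <= G * `|c| by rewrite mulr_ge0// ltW.
have C0 : 0 < C by rewrite /C; lra.
pose e := Num.min (1 / 2) (eps / C).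
have e0 : 0 < e by rewrite lt_min !divr_gt0.
have e2 : e <= 1 / 2 by rewrite ge_min lexx.
have e1 : e <= 1 by lra.
have eC : e * C <= eps by rewrite -ler_pdivlMr// ge_min lexx orbT.
have [s sP] := fibers_totally_bounded compM uPhi bPhi e0.
have [N0 HN0] := aPhi e0.
have [I [w [W [ctr [[w0 w1] Woo inj corrP]]]]] := block_LLT LLT e0.
have c1 : continuous (cst 1 : M -> R) by move=> y; exact: cvg_cst.
have I0 : 0 < #|I|%:R :> R.
  rewrite ltr0n lt0n; apply/eqP => I0; move: w1; rewrite big_pred0.
    by rewrite sub0r normrN normr1; lra.
  by move=> i; apply: (card0_eq I0).
have q1near : \forall n \near \oo, forall i (k : {ffun 'I_d -> 'I_(W n)}),
    `|(W n)%:R ^+ d * corr n (cst 1) (cst 1) (cube_point (ctr n i) k) - w i|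
     <= e * 2 / #|I|%:R.
  have := corrP _ _ c1 c1; rewrite !prob_Rintegral_cst mulr1 normr1.
  by apply: filterS => m H i' k'; rewrite -[w i']mul1r; exact: H.
have qsnear : \forall n \near \oo, forall z', z' \in s ->
    forall i (k : {ffun 'I_d -> 'I_(W n)}),
    `|(W n)%:R ^+ d * corr n g (fun y => Phi (y, z')) (cube_point (ctr n i) k) -
      ng * A z' * w i| <= e * (1 + G * B) / #|I|%:R.
  apply: near_seq => z'; have := corrP _ _ cg (cPhi z').
  apply: filterS => m H i k; apply: le_trans (H i k) _.
  rewrite ler_pM2r ?invr_gt0// ler_pM2l// lerD2l normrM ler_pM//.
  exact: AB.
near=> n => z.
have Wn : (N0 < W n)%N by near: n; exact: Woo.
have q1 : forall i (k : {ffun 'I_d -> 'I_(W n)}),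
    `|(W n)%:R ^+ d * corr n (cst 1) (cst 1) (cube_point (ctr n i) k) - w i|
     <= e * 2 / #|I|%:R by near: n; exact: q1near.
have qs : forall z', z' \in s -> forall i (k : {ffun 'I_d -> 'I_(W n)}),
    `|(W n)%:R ^+ d * corr n g (fun y => Phi (y, z')) (cube_point (ctr n i) k) -
      ng * A z' * w i| <= e * (1 + G * B) / #|I|%:R by near: n; exact: qsnear.
pose V : R := (W n)%:R ^+ d.
pose K := {ffun 'I_d -> 'I_(W n)}.
pose pt (ik : I * K) := cube_point (ctr n ik.1) ik.2.
have V0 : 0 < V by rewrite exprn_gt0// ltr0n (leq_ltn_trans _ Wn).
have cardK : #|{: K}|%:R = V by rewrite card_ffun !card_ord natrX.
have avg i : `|V^-1 * \sum_(k : K) A (z + pt (i, k)) - c| <= e.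
  have := HN0 (z + ctr n i) (W n) Wn.
  rewrite (cube_averageE _ _ _ mPhi PhiB) natrX.
  by under eq_bigr do rewrite cube_pointD.
pose q ik := corr n (cst 1) (cst 1) (pt ik).
pose a ik := corr n g (fun y => Phi (y, z + pt ik)) (pt ik).
(* The fiber at level [z + pt ik] is replaced by a fiber of the finite net, for
   which the block limit theorem is uniform, and then put back. *)
have aP ik : `|a ik - ng * A (z + pt ik) * (w ik.1 / V)| <=
    G * e * q ik + (e * (1 + G * B) / #|I|%:R / V + G * e * (w ik.1 / V)).
  have [z' zs zz'] := sP (z + pt ik).
  pose a' := corr n g (fun y => Phi (y, z')) (pt ik).
  have -> : a ik - ng * A (z + pt ik) * (w ik.1 / V) =
    (a ik - a') + ((V * a' - ng * A z' * w ik.1) / V +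
      ng * (A z' - A (z + pt ik)) * (w ik.1 / V)).
    by field; exact: lt0r_neq0.
  apply: le_trans (ler_normD _ _) _; apply: lerD.
    exact: (correlation_lipschitz nu mf mtau n (pt ik) mg (mPhiz _) (mPhiz _)
      gG (fun y => PhiB (y, _)) (fun y => PhiB (y, _)) zz').
  apply: le_trans (ler_normD _ _) _; apply: lerD.
    have V'0 : 0 < V^-1 by rewrite invr_gt0.
    rewrite normrM (gtr0_norm V'0) ler_pM2r//.
    exact: (qs z' zs ik.1 ik.2).
  have wV : 0 <= w ik.1 / V by rewrite divr_ge0// ltW.
  rewrite normrM (ger0_norm wV) ler_wpM2r// normrM ler_pM//.
  rewrite /A -RintegralB//; last 2 first.
  - exact: (@bounded_integrable _ _ _ nu _ B).
  - exact: (@bounded_integrable _ _ _ nu _ B).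
  apply: normr_Rintegral_bounded; first exact: measurable_funB.
  by move=> y; rewrite distrC.
have sumI (F : I -> R) : \sum_(ik : I * K) F ik.1 / V = \sum_i F i.
  rewrite -(pair_bigA _ (fun i (k : K) => F i / V)) /=.
  apply: eq_bigr => i _; rewrite sumr_const -[LHS]mulr_natr.
  by rewrite cardK divfK// lt0r_neq0.
have sumcst (x : R) : \sum_(i : I) x / #|I|%:R = x.
  by rewrite sumr_const -[LHS]mulr_natr divfK// lt0r_neq0.
have wle : \sum_i w i <= 1 + e by move: w1; rewrite ler_norml => /andP[_]; lra.
have wge : 1 - e <= \sum_i w i.
  by move: w1; rewrite ler_norml => /andP[+ _]; lra.
have w00 : 0 <= \sum_i w i by exact: sumr_ge0.
have q_le1 : \sum_ik q ik <= 1.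
  exact: (sum_correlation1_le1 nu mf mtau (inj n) n).
have q_ge : 1 - 3 * e <= \sum_ik q ik.
  have : \sum_(ik : I * K) (w ik.1 - e * 2 / #|I|%:R) / V <= \sum_ik q ik.
    apply: ler_sum => -[i k] _; rewrite ler_pdivrMr// [leRHS]mulrC /=.
    have := q1 i k; rewrite ler_norml -/V /q /pt /= => /andP[+ _].
    by move: (V * _) => X; lra.
  rewrite (sumI (fun i => w i - e * 2 / #|I|%:R)) sumrB sumcst; lra.
have tail : `|\int[nu]_y (g y * Phi (iter n f y, z + S n y)) - \sum_ik a ik| <=
    G * B * (3 * e).
  apply: le_trans
    (orbit_integral_split nu mf mtau (inj n) n z mg mPhi gG PhiB) _.
  by rewrite ler_pM2l//; rewrite -/pt in q_ge *; move: q_ge; rewrite /q; lra.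
have bulk :
    `|\sum_ik a ik - \sum_ik ng * A (z + pt ik) * (w ik.1 / V)| <=
    G * e + e * (1 + G * B) + G * e * (1 + e).
  rewrite -sumrB; apply: le_trans (ler_norm_sum _ _ _) _.
  apply: le_trans (ler_sum _ (fun ik _ => aP ik)) _.
  rewrite big_split /= -mulr_sumr big_split /=.
  rewrite [X in _ + (_ + X)](_ : _ = G * e * \sum_i w i); last first.
    by rewrite -mulr_sumr sumI.
  rewrite (sumI (fun=> e * (1 + G * B) / #|I|%:R)) sumcst addrA.
  have Ge0 : 0 < G * e by exact: mulr_gt0.
  rewrite lerD//; last by rewrite ler_pM2l.
  by rewrite lerD// -[leRHS]mulr1 ler_pM2l.
have main :
    `|\sum_ik ng * A (z + pt ik) * (w ik.1 / V) - ng * c * \sum_i w i| <=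
    G * (1 + e) * e.
  rewrite -(pair_bigA _
    (fun i (k : K) => ng * A (z + pt (i, k)) * (w i / V))) /=.
  rewrite mulr_sumr -sumrB.
  have -> : \sum_i (\sum_(k : K) ng * A (z + pt (i, k)) * (w i / V) -
      ng * c * w i) =
     ng * \sum_i w i * (V^-1 * \sum_(k : K) A (z + pt (i, k)) - c).
    rewrite mulr_sumr; apply: eq_bigr => i _.
    rewrite -mulr_suml -mulr_sumr; field; exact: lt0r_neq0.
  rewrite normrM -mulrA ler_pM//.
  apply: le_trans (ler_norm_sum _ _ _) _.
  apply: (@le_trans _ _ (\sum_i w i * e)).
    by apply: ler_sum => i _; rewrite normrM (ger0_norm (w0 i)) ler_wpM2l.
  by rewrite -mulr_suml ler_pM2r.
have mass : `|ng * c * \sum_i w i - ng * c| <= G * `|c| * e.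
  by rewrite -[X in _ - X]mulr1 -mulrBr normrM ler_pM// normrM ler_wpM2r.
apply: le_trans eC.
have Gee : G * e * e <= G * e by rewrite -[leRHS]mulr1 ler_pM2l// mulr_gt0.
have GBe : 0 < G * B * e by exact: mulr_gt0.
rewrite /C; move: tail bulk main mass; rewrite !ler_norml.
set X1 := \int[nu]_y _; set X2 := \sum_ik _; set X3 := \sum_ik _.
set X4 := ng * c * _.
move=> /andP[t1 t2] /andP[b1 b2] /andP[m1 m2] /andP[s1 s2].
by apply/andP; split; lra.
Unshelve. all: by end_near. Qed.

End equidistribution_continuous.

(** * Density of continuous functions *)

Import HBSimple.

Section density.
Context (disp : measure_display) (R : realType).
Context (M : borelMetricType disp R) (nu : probability M R).

(** [g] is an [L^1]-limit of bounded continuous functions. *)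
Definition L1_approximable (g : M -> R) := forall eps : R, 0 < eps ->
  exists h : M -> R, [/\ continuous h, exists B, forall y, `|h y| <= B &
    \int[nu]_y `|g y - h y| <= eps].

Let idiff (g h : M -> R) : nu.-integrable setT (EFin \o g) ->
  nu.-integrable setT (EFin \o h) ->
  nu.-integrable setT (EFin \o (fun y => `|g y - h y|)).
Proof.
move=> ig ih; apply: (@integrable_norm _ _ _ _ _ (fun y => g y - h y)).
by apply: eq_integrable (integrableB measurableT ig ih).
Qed.

Let icont (h : M -> R) B : continuous h -> (forall y, `|h y| <= B) ->
  nu.-integrable setT (EFin \o h).
Proof.
by move=> ch; apply: bounded_integrable; exact: borel_continuous_measurable.
Qed.

Lemma L1_dist_triangle (g h k : M -> R) : nu.-integrable setT (EFin \o g) ->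
  nu.-integrable setT (EFin \o h) -> nu.-integrable setT (EFin \o k) ->
  \int[nu]_y `|g y - k y| <=
  \int[nu]_y `|g y - h y| + \int[nu]_y `|h y - k y|.
Proof.
move=> ig ih ik; rewrite -RintegralD//; [|exact: idiff|exact: idiff].
apply: le_Rintegral => //; first exact: idiff.
  by apply: eq_integrable (integrableD measurableT (idiff ig ih) (idiff ih ik)).
by move=> y _; rewrite ler_distD.
Qed.

Lemma L1_approximable_closed (g : M -> R) : nu.-integrable setT (EFin \o g) ->
  (forall eps, 0 < eps -> exists g' : M -> R,
    [/\ nu.-integrable setT (EFin \o g'), L1_approximable g' &
        \int[nu]_y `|g y - g' y| <= eps]) ->
  L1_approximable g.
Proof.
move=> ig H eps eps0; have e20 : 0 < eps / 2 by rewrite divr_gt0.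
have [g' [ig' ag' gg']] := H _ e20; have [h [ch [B hB] g'h]] := ag' _ e20.
exists h; split=> //; first by exists B.
apply: le_trans (L1_dist_triangle ig ig' (icont ch hB)) _.
by rewrite [leRHS]splitr lerD.
Qed.

Lemma L1_approximable_continuous (g : M -> R) B : continuous g ->
  (forall y, `|g y| <= B) -> L1_approximable g.
Proof.
move=> cg gB eps eps0; exists g; split=> //; first by exists B.
under eq_Rintegral do rewrite subrr normr0.
by rewrite prob_Rintegral_cst ltW.
Qed.

Lemma L1_approximable_linear (a : R) (g1 g2 : M -> R) :
  nu.-integrable setT (EFin \o g1) -> nu.-integrable setT (EFin \o g2) ->
  L1_approximable g1 -> L1_approximable g2 ->
  L1_approximable (fun y => g1 y + a * g2 y).
Proof.
move=> ig1 ig2 ag1 ag2 eps eps0.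
have a0 : 0 < 1 + `|a| by rewrite ltr_wpDr.
have e0 : 0 < eps / (1 + `|a|) by rewrite divr_gt0.
have [h1 [ch1 [B1 hB1] gh1]] := ag1 _ e0.
have [h2 [ch2 [B2 hB2] gh2]] := ag2 _ e0.
exists (fun y => h1 y + a * h2 y); split.
- by move=> y; apply: cvgD; [exact: ch1|apply: cvgMr; exact: ch2].
- exists (B1 + `|a| * B2) => y; apply: le_trans (ler_normD _ _) _.
  by rewrite lerD// normrM ler_wpM2l.
have i1 := idiff ig1 (icont ch1 hB1); have i2 := idiff ig2 (icont ch2 hB2).
have ia : nu.-integrable setT (EFin \o (fun y => `|a| * `|g2 y - h2 y|)).
  by apply: eq_integrable (integrableZl measurableT `|a| i2).
have ig12 : nu.-integrable setT (EFin \o (fun y => g1 y + a * g2 y)).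
  by apply: eq_integrable (integrableD measurableT ig1
    (integrableZl measurableT a ig2)).
have ih12 : nu.-integrable setT (EFin \o (fun y => h1 y + a * h2 y)).
  by apply: eq_integrable (integrableD measurableT (icont ch1 hB1)
    (integrableZl measurableT a (icont ch2 hB2))).
apply: (@le_trans _ _ (\int[nu]_y (`|g1 y - h1 y| + `|a| * `|g2 y - h2 y|))).
  apply: le_Rintegral => //; first exact: idiff.
    by apply: eq_integrable (integrableD measurableT i1 ia).
  move=> y _; rewrite -normrM (le_trans _ (ler_normD _ _))//.
  by rewrite le_eqVlt; apply/orP; left; apply/eqP; congr `|_|; ring.
rewrite RintegralD// RintegralZl//.
apply: (@le_trans _ _ (eps / (1 + `|a|) + `|a| * (eps / (1 + `|a|)))).
  by rewrite lerD// ler_wpM2l.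
by rewrite -[X in X + _]mul1r -mulrDl mulrC divfK// lt0r_neq0.
Qed.

(** Approximability passes to bounded limits which are eventually constant at
    every point. *)
Lemma L1_approximable_lim (u : nat -> M -> R) (g : M -> R) (B : R) :
  measurable_fun setT g ->
  (forall n, measurable_fun setT (u n)) -> (forall n y, `|u n y| <= B) ->
  (forall y, \forall n \near \oo, u n y = g y) ->
  (forall n, L1_approximable (u n)) -> L1_approximable g.
Proof.
move=> mg mu uB ug au.
have gB y : `|g y| <= B.
  by have [n _ /(_ n (leqnn n)) <-] := ug y.
have ig := bounded_integrable nu mg gB.
have iu n := bounded_integrable nu (mu n) (uB n).
have cv : (\int[nu]_y (`|g y - u n y|)%:E)%E @[n --> \oo] -->
    (\int[nu]_y (cst 0 y))%E.
  apply: (@dominated_cvg _ _ _ _ _ measurableT _ _ (EFin \o cst (2 * B))) => //.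
  - move=> n; apply/measurable_EFinP/measurableT_comp => //.
    exact: measurable_funB.
  - move=> y _; apply: cvg_near_cst; have := ug y.
    by apply: filterS => n ->; rewrite subrr normr0.
  - by apply: (@bounded_integrable _ _ _ nu (cst (2 * B)) `|2 * B|).
  - move=> n y _ /=; rewrite lee_fin normr_id (le_trans (ler_normB _ _))//.
    by rewrite mulr_natl mulr2n lerD.
rewrite integral0 in cv.
apply: L1_approximable_closed => // eps eps0.
move: cv => /fine_cvgP[_ /cvgrPdist_le /(_ _ eps0)] [n _ /(_ n (leqnn n)) /=].
rewrite sub0r normrN => h; exists (u n); split=> //.
exact: le_trans (ler_norm _) h.
Qed.

Let iindic (A : set M) : measurable A ->
  nu.-integrable setT (EFin \o (\1_A : M -> R)).
Proof.
move=> mA; apply: (@bounded_integrable _ _ _ nu _ 1).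
  exact: measurable_indic.
by move=> y; rewrite indicE normr_nat; case: (_ \in _).
Qed.

(** The indicator of an open set [U] is the limit of Urysohn functions which
    separate the complement of [U] from the points at distance at least
    [1 / (n + 1)] from it. *)
Lemma L1_approximable_open (U : set M) : open U -> L1_approximable \1_U.
Proof.
move=> oU.
pose F (n : nat) := [set y | forall a, ~ U a -> ~ ball a n.+1%:R^-1 y].
have sep n : uniform_separator (~` U) (F n).
  apply: uniform_separatorW; exists [set ay | ball ay.1 n.+1%:R^-1 ay.2].
    rewrite -entourage_ballE; exists n.+1%:R^-1 => //=.
  by apply/seteqP; split=> // -[a y] [[/= Ua /(_ _ Ua)]].
pose u n : M -> R := Urysohn (~` U) (F n).
have cu n : continuous (u n) by exact: Urysohn_continuous.
have uB n y : `|u n y| <= 1.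
  have : range (u n) (u n y) by exists y.
  move=> /(@Urysohn_range M R); rewrite /= in_itv /= => /andP[u0 u1].
  by rewrite ger0_norm.
apply: (@L1_approximable_lim u _ 1) => //.
- by apply: measurable_indic; exact: borel_open_measurable.
- by move=> n; exact: borel_continuous_measurable.
- move=> y; rewrite indicE; case: (boolP (y \in U)); rewrite ?inE => Uy.
    have /nbhs_ballP[e /= e0 yU] := open_nbhs_nbhs (conj oU Uy).
    near=> n; apply: (Urysohn_sub1 (sep n)); exists y => // a Ua ay.
    apply/Ua/yU/ball_sym; apply: le_ball ay.
    rewrite invf_ple ?posrE//.
    apply: (@le_trans _ _ n%:R); last by rewrite ler_nat.
    by near: n; exact: nbhs_infty_ger.
  near=> n; apply: (Urysohn_sub0 (sep n)); exists y => //.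
  by rewrite notin_setE in Uy.
- by move=> n; apply: L1_approximable_continuous (uB n).
Unshelve. all: by end_near. Qed.

(** The measurable sets with an approximable indicator form a Dynkin system
    containing the open sets, which are stable under intersection. *)
Lemma L1_approximable_indic (A : set M) : measurable A -> L1_approximable \1_A.
Proof.
rewrite measurable_borelE; move: A.
apply: (@dynkin_induction _ M (@open M) (fun A => L1_approximable \1_A)).
- exact: measurable_borelE.
- by move=> U V; exact: openI.
- apply: L1_approximable_open; exact: openT.
- exact: L1_approximable_open.
- move=> B mB aB.
  have -> : \1_(~` B) = (fun y => 1 + (- 1) * \1_B y) :> (M -> R).
    apply/funext => y; rewrite !indicE in_setC; case: (y \in B) => /=; ring.
  have i1 : nu.-integrable setT (EFin \o (cst 1 : M -> R)).
    by apply: (@bounded_integrable _ _ _ nu (cst 1) 1) => // y; rewrite normr1.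
  have a1 : L1_approximable (cst 1).
    apply: (@L1_approximable_continuous _ 1) => y; first exact: cvg_cst.
    by rewrite normr1.
  exact: (L1_approximable_linear (-1) i1 (iindic mB) a1 aB).
move=> F mF tF aF; pose u n : M -> R := fun y => \sum_(k < n) \1_(F k) y.
have uE n y : u n y = (`[< exists2 k, (k < n)%N & F k y >])%:R.
  rewrite /u; case: asboolP => [[k kn Fk]|nF].
    rewrite (bigD1 (Ordinal kn))//= indicE mem_set// big1 ?addr0// => j jk.
    rewrite indicE memNset// => Fj; move: jk.
    rewrite -val_eqE /=; apply/negP; rewrite negbK.
    by apply/eqP/(tF _ _ I I); exists y.
  rewrite big1// => k _; rewrite indicE memNset// => Fk.
  by apply: nF; exists k.
have mu n : measurable_fun setT (u n).
  by apply: measurable_sum => k; exact: measurable_indic.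
have uB n y : `|u n y| <= 1 by rewrite uE normr_nat; case: asboolP.
apply: (@L1_approximable_lim u _ 1) => //.
- by apply: measurable_indic; exact: bigcup_measurable.
- move=> y; rewrite indicE; case: (boolP (y \in _)); rewrite ?inE => Fy.
    have [k _ Fk] := Fy; near=> n; rewrite uE asboolT//; exists k => //.
    by near: n; exact: nbhs_infty_gt.
  near=> n; rewrite uE asboolF// => -[k _ Fk]; rewrite notin_setE in Fy.
  by apply: Fy; exists k.
- elim=> [|n IH].
    have -> : u 0%N = cst 0 by apply/funext => y; rewrite /u big_ord0.
    apply: (@L1_approximable_continuous _ 0) => y; first exact: cvg_cst.
    by rewrite normr0.
  have -> : u n.+1 = (fun y => u n y + 1 * \1_(F n) y).
    by apply/funext => y; rewrite /u big_ord_recr /= mul1r.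
  apply: L1_approximable_linear => //; last exact: iindic.
  exact: bounded_integrable (mu n) (uB n).
Unshelve. all: by end_near. Qed.

(** Bounded continuous functions are dense in [L^1] of a Borel probability
    measure on a metric space. *)
Lemma L1_approximable_integrable (g : M -> R) :
  nu.-integrable setT (EFin \o g) -> L1_approximable g.
Proof.
move=> ig; apply: L1_approximable_closed => // eps eps0.
have [s [iS _ /fine_cvgP[_ /cvgrPdist_le/(_ _ eps0)]]] :=
  approximation_sfun_integrable measurableT ig.
move=> [n _ /(_ n (leqnn n)) /=]; rewrite sub0r normrN => h.
exists (s n : M -> R); split; [exact: iS| |]; last first.
  exact: le_trans (ler_norm _) h.
pose S := finmap.enum_fset (fset_set (s n @` setT)).
have -> : s n =
      (fun y => \sum_(i < size S) (S`_i * \1_(s n @^-1` [set S`_i]) y))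
    :> (M -> R) by apply/funext => y; exact: fimfunEord.
have mA i : measurable (s n @^-1` [set S`_i]).
  by rewrite -[X in measurable X]setTI; exact: measurable_funPT.
suff : nu.-integrable setT (EFin \o (fun y =>
      \sum_(i < size S) (S`_i * \1_(s n @^-1` [set S`_i]) y))) /\
    L1_approximable (fun y =>
      \sum_(i < size S) (S`_i * \1_(s n @^-1` [set S`_i]) y)) by case.
elim: (size S) => [|k [IHi IHa]].
  have -> : (fun y => \sum_(i < 0) (S`_i * \1_(s n @^-1` [set S`_i]) y)) = cst 0
      :> (M -> R) by apply/funext => y; rewrite big_ord0.
  split.
    by apply: (@bounded_integrable _ _ _ nu (cst 0) 0) => // y; rewrite normr0.
  apply: (@L1_approximable_continuous _ 0) => y; first exact: cvg_cst.
  by rewrite normr0.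
have -> : (fun y => \sum_(i < k.+1) (S`_i * \1_(s n @^-1` [set S`_i]) y)) =
    (fun y => \sum_(i < k) (S`_i * \1_(s n @^-1` [set S`_i]) y) +
       S`_k * \1_(s n @^-1` [set S`_k]) y).
  by apply/funext => y; rewrite big_ord_recr.
split; last first.
  apply: L1_approximable_linear => //; first exact: iindic.
  exact: L1_approximable_indic.
by apply: eq_integrable (integrableD measurableT IHi
  (integrableZl measurableT S`_k (iindic (mA k)))).
Qed.

End density.

(** * Upper and lower limits along large cubes *)

Section upper_lower_limits.
Context (R : realType).

Lemma cvg_EFin_sandwich (u : nat -> \bar R) (c : R) :
  (forall e, 0 < e ->
    \forall n \near \oo, ((c - e)%:E <= u n <= (c + e)%:E)%E) ->
  u @ \oo --> c%:E.
Proof.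
move=> H; apply/fine_cvgP; split.
  have := H 1 ltr01; apply: filterS => n /andP[h1 h2].
  by rewrite fin_numElt (lt_le_trans _ h1) ?ltNyr// (le_lt_trans h2) ?ltry.
apply/cvgrPdist_le => e e0; have := H e e0; apply: filterS => n /= /andP[].
case: (u n) => //= r; rewrite !lee_fin distrC ler_norml => ? ?.
by apply/andP; split; lra.
Qed.

(** If [u] is within [e] of [c] on a set [V] of [F] which meets every set of
    [F], then so are its upper and lower limits along [F]. *)
Lemma limf_esup_near (T : choiceType) (X : filteredType T)
    (F : set (set X)) (u : X -> R) (V : set X)
    (c e : R) :
  F V -> (forall V', F V' -> V `&` V' !=set0) ->
  (forall x, V x -> `|u x - c| <= e) ->
  ((c - e)%:E <= limf_esup (fun x => (u x)%:E) F <= (c + e)%:E)%E.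
Proof.
move=> FV meet Vu; rewrite limf_esupE; apply/andP; split.
  apply: le_ereal_inf_tmp => _ [V' FV' <-]; have [x [Vx V'x]] := meet _ FV'.
  apply: (@le_trans _ _ (u x)%:E).
    by have := Vu _ Vx; rewrite lee_fin ler_norml => /andP[]; lra.
  by apply: ereal_sup_ubound; exists x.
apply: ge_ereal_inf; exists (ereal_sup ((fun x => (u x)%:E) @` V)).
  by exists V.
apply: ge_ereal_sup => _ [x Vx <-].
by have := Vu _ Vx; rewrite lee_fin ler_norml => /andP[]; lra.
Qed.

Lemma limf_einf_near (T : choiceType) (X : filteredType T)
    (F : set (set X)) (u : X -> R) (V : set X)
    (c e : R) :
  F V -> (forall V', F V' -> V `&` V' !=set0) ->
  (forall x, V x -> `|u x - c| <= e) ->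
  ((c - e)%:E <= limf_einf (fun x => (u x)%:E) F <= (c + e)%:E)%E.
Proof.
move=> FV meet Vu; rewrite /limf_einf.
have := @limf_esup_near _ _ F (fun x => - u x) V (- c) e FV meet.
have -> : (fun x => (- u x)%:E) = (\- (fun x => (u x)%:E))%E by [].
have {}Vu x : V x -> `|- u x - - c| <= e by rewrite -opprD normrN; exact: Vu.
move=> /(_ Vu) /andP[h1 h2].
apply/andP; split.
  by rewrite leeNr -EFinN (le_trans h2)// lee_fin; lra.
by rewrite leeNl -EFinN (le_trans _ h1)// lee_fin; lra.
Qed.

End upper_lower_limits.

Section large_cubes.
Context (disp : measure_display) (R : realType) (d : nat).
Context (M : borelMetricType disp R) (nu : probability M R).
Local Notation mu := (extension_measure d nu).
Hypothesis d0 : (0 < d)%N.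

Lemma large_cubes_size (N0 : nat) :
  large_cubes mu [set zw | (N0 < zw.2)%N].
Proof.
exists (N0 ^ d)%:R => // -[z w] /=.
by rewrite [X in (_ < X)%E]mu_cube lte_fin ltr_nat ltn_exp2r.
Qed.

(** Since [0 < d], there are cubes of arbitrarily large measure, so that the
    limits along large cubes are not vacuous. *)
Lemma large_cubes_meet (V V' : set (Zd d * nat)) :
  large_cubes mu V -> large_cubes mu V' -> V `&` V' !=set0.
Proof.
move=> [A _ AV] [A' _ AV']; pose w := (Num.truncn (Num.max `|A| `|A'|)).+1.
exists (0, w).
have : Num.max `|A| `|A'| < (w ^ d)%:R.
  apply: (@lt_le_trans _ _ w%:R); first exact: truncnS_gt.
  by rewrite ler_nat -[X in (X <= _)%N]expn1 leq_pexp2l.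
rewrite gt_max => /andP[hA hA']; split.
  apply: AV => /=; rewrite [X in (_ < X)%E]mu_cube lte_fin.
  exact: le_lt_trans (ler_norm A) _.
apply: AV' => /=; rewrite [X in (_ < X)%E]mu_cube lte_fin.
exact: le_lt_trans (ler_norm A') _.
Qed.

End large_cubes.

(** * Local global and global global mixing *)

Section mixing.
Context (disp : measure_display) (R : realType) (d : nat).
Context (M : borelMetricType disp R) (nu : probability M R).
Variables (f : M -> M) (tau : M -> Zd d) (L : nat -> R).
Hypothesis d0 : (0 < d)%N.
Hypothesis compM : compact [set: M].
Hypotheses (mf : measurable_fun setT f) (mtau : measurable_fun setT tau).
Hypothesis LLT : shifted_mixing_LLT nu f tau L.
Local Notation S := (birkhoff_sum f tau).
Local Notation mu := (extension_measure d nu).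
Local Notation T := (skew_product f tau).

(** Extension to integrable [g] by density, [Phi] being bounded. *)
Lemma equidistribution_integrable (Phi : M * Zd d -> R) (c : R) (g : M -> R)
    (eps : R) :
  bounded_fun Phi -> unif_continuous Phi -> has_average mu Phi c ->
  nu.-integrable setT (EFin \o g) -> 0 < eps ->
  \forall n \near \oo, forall z,
    `|\int[nu]_y (g y * Phi (iter n f y, z + S n y)) - (\int[nu]_y g y) * c|
    <= eps.
Proof.
move=> bPhi uPhi aPhi ig eps0; have [B B0 PhiB] := bounded_funP bPhi.
have mPhi := measurable_observable uPhi.
have C0 : 0 < B + `|c| by rewrite ltr_wpDr.
pose e := eps / 2 / (B + `|c|).
have e0 : 0 < e by rewrite !divr_gt0.
have [h [ch [Bh hB] gh]] := L1_approximable_integrable ig e0.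
have ih := bounded_integrable nu (borel_continuous_measurable ch) hB.
have igh : nu.-integrable setT (EFin \o (fun y => g y - h y)).
  by apply: eq_integrable (integrableB measurableT ig ih).
have e20 : 0 < eps / 2 by rewrite divr_gt0.
have := equidistribution_continuous compM mf mtau LLT bPhi uPhi aPhi ch e20.
apply: filterS => n near_h z.
have iPhi (k : M -> R) : nu.-integrable setT (EFin \o k) ->
    nu.-integrable setT (EFin \o (fun y => k y * Phi (iter n f y, z + S n y))).
  move=> ik; apply: integrableM_bounded ik _ (fun y => PhiB _).
  exact: measurable_orbit.
have -> :
    \int[nu]_y (g y * Phi (iter n f y, z + S n y)) - (\int[nu]_y g y) * c =
    \int[nu]_y ((g y - h y) * Phi (iter n f y, z + S n y)) +
    (\int[nu]_y (h y * Phi (iter n f y, z + S n y)) - (\int[nu]_y h y) * c) -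
    (\int[nu]_y (g y - h y)) * c.
  rewrite (RintegralB _ ig ih)//.
  under [X in _ = X + _ - _]eq_Rintegral do rewrite mulrBl.
  by rewrite (RintegralB _ (iPhi _ ig) (iPhi _ ih))//; ring.
have b1 : `|\int[nu]_y ((g y - h y) * Phi (iter n f y, z + S n y))| <= e * B.
  apply: le_trans (le_normr_Rintegral measurableT (iPhi _ igh)) _.
  apply: (@le_trans _ _ (\int[nu]_y (`|g y - h y| * B))).
    apply: le_Rintegral => //; first exact: (integrable_norm (iPhi _ igh)).
      by apply: eq_integrable
        (integrableZr measurableT B (integrable_norm igh)).
    by move=> y _; rewrite normrM ler_wpM2l.
  by rewrite (RintegralZr _ _ (integrable_norm igh))// ler_pM2r.
have b2 : `|(\int[nu]_y (g y - h y)) * c| <= e * `|c|.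
  rewrite normrM ler_wpM2r//.
  exact: le_trans (le_normr_Rintegral measurableT igh) _.
have eE : e * B + e * `|c| = eps / 2.
  by rewrite -mulrDr divfK// lt0r_neq0.
apply: le_trans (ler_normB _ _) _.
have := ler_normD (\int[nu]_y ((g y - h y) * Phi (iter n f y, z + S n y)))
   (\int[nu]_y (h y * Phi (iter n f y, z + S n y)) - (\int[nu]_y h y) * c).
have := near_h z; lra.
Qed.

Lemma measurable_skew_product : measurable_fun setT T.
Proof.
apply/measurable_fun_pairP; split.
  exact: (measurableT_comp mf measurable_fst).
apply: measurable_fun_slices => z.
exact: (measurable_ZdD (measurable_cst z) mtau).
Qed.

Lemma measurable_iter_skew_product n : measurable_fun setT (iter n T).
Proof.
elim: n => [|n IH] /=; first exact: measurable_id.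
exact: (measurableT_comp measurable_skew_product IH).
Qed.

(** By Fubini the integral over [M * Zd d] is a sum over levels of integrals
    over [M], each of which converges; the sum converges by domination. *)
Lemma local_global_mixing_LLT : local_global_mixing mu T (GU mu).
Proof.
move=> phi Phi c iphi [bPhi uPhi _] aPhi.
have [B B0 PhiB] := bounded_funP bPhi.
have mPhi := measurable_observable uPhi.
have /integrableP[/measurable_EFinP mphi phifin] := iphi.
have mPhiT n : measurable_fun setT (Phi \o iter n T).
  exact: (measurableT_comp mPhi (measurable_iter_skew_product n)).
have iF n : mu.-integrable setT (EFin \o (fun x => phi x * Phi (iter n T x))).
  exact: integrableM_bounded iphi (mPhiT n) (fun x => PhiB _).
have ic : mu.-integrable setT (EFin \o (fun x => phi x * c)).
  by apply: (@integrableM_bounded _ _ _ _ phi (cst c) `|c|).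
pose G z := (\int[nu]_y `|(phi (y, z))%:E|)%E.
have G0 z : (0 <= G z)%E by exact: integral_ge0.
have Gint : (\int[@counting_Zd R d]_z G z < +oo)%E.
  apply: le_lt_trans phifin.
  have mabs : measurable_fun setT (abse \o (EFin \o phi)).
    exact/measurableT_comp/measurable_EFinP.
  by have -> := fubini_tonelli2 (m1 := nu) (m2 := @counting_Zd R d) _ mabs
    (fun x => abse_ge0 _).
(* A function with a finite integral for the counting measure is finite at
   every point. *)
have Gfin z : (G z < +oo)%E.
  apply: le_lt_trans Gint.
  apply: (@le_trans _ _ (\int[@counting_Zd R d]_(w in [set z]) G w)%E).
    rewrite (eq_integral (cst (G z))); last by move=> w; rewrite inE /= => ->.
    by rewrite integral_cst// [X in (_ * X)%E]counting_Zd1 mule1.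
  exact: ge0_subset_integral.
have iphiz z : nu.-integrable setT (EFin \o (fun y => phi (y, z))).
  apply/integrableP; split; last exact: Gfin.
  exact/measurable_EFinP/measurable_fun_slice.
have cv : (\int[mu]_x (phi x * Phi (iter n T x))%:E)%E @[n --> \oo] -->
    (\int[mu]_x (phi x * c)%:E)%E.
  rewrite -(integral21_prod_meas1 ic).
  under eq_fun do rewrite -(integral21_prod_meas1 (iF _)).
  apply: (@dominated_cvg _ _ _ (@counting_Zd R d) _ measurableT _ _
    (fun z => (B%:E * G z)%E)) => //.
  - move=> z _; rewrite /fubini_G /=.
    have -> : (\int[nu]_y (phi (y, z) * c)%:E)%E =
        ((\int[nu]_y phi (y, z)) * c)%:E.
      rewrite -RintegralZr// /Rintegral fineK//.
      apply: integrable_fin_num => //.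
      by apply: (@integrableM_bounded _ _ _ _ _ (cst c) `|c| (iphiz z)).
    apply/fine_cvgP; split.
      apply: nearW => n; apply: integrable_fin_num => //.
      exact: integrableM_bounded (iphiz z) (measurable_fun_slice z (mPhiT n))
        (fun y => PhiB _).
    apply/cvgrPdist_le => e e0.
    have := equidistribution_integrable bPhi uPhi aPhi (iphiz z) e0.
    apply: filterS => n /(_ z); rewrite distrC /=.
    by under eq_integral do rewrite iter_skew_product.
  - by move=> z _; rewrite fin_numM// ge0_fin_numE.
  - apply: integrableZl => //; apply/integrableP; split=> //.
    by under eq_integral do rewrite gee0_abs//.
  - move=> n z _; rewrite /fubini_G /=.
    have mabs : measurable_fun setT (fun y => `|(phi (y, z))%:E|%E).
      exact/measurableT_comp/measurable_EFinP/measurable_fun_slice.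
    have mPz := measurable_fun_slice z (mPhiT n).
    have mpz := measurable_fun_slice z mphi.
    apply: le_trans (le_abse_integral _ _ _) _ => //.
      exact/measurable_EFinP/measurable_funM.
    rewrite -ge0_integralZl//; last by rewrite lee_fin ltW.
    apply: ge0_le_integral => //.
    - by apply: measurableT_comp => //; exact/measurable_EFinP/measurable_funM.
    - exact: measurable_funeM.
    - move=> y _; rewrite /= -EFinM lee_fin normrM mulrC ler_wpM2r//.
have cE : (\int[mu]_x (phi x * c)%:E = ((\int[mu]_x phi x) * c)%:E)%E.
  by rewrite -RintegralZr// /Rintegral fineK//; exact: integrable_fin_num.
by rewrite cE in cv; exact: fine_cvg cv.
Qed.

(** Uniformity in [z] comes from total boundedness of the fibers of [Phi1]: the
    equidistribution estimate is needed for finitely many of them. *)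
Lemma fiber_averages_mixing (Phi1 Phi2 : M * Zd d -> R) (c2 eps : R) :
  bounded_fun Phi1 -> unif_continuous Phi1 ->
  bounded_fun Phi2 -> unif_continuous Phi2 -> has_average mu Phi2 c2 ->
  0 < eps ->
  \forall n \near \oo, forall z,
    `|\int[nu]_y (Phi1 (y, z) * Phi2 (iter n T (y, z))) -
      (\int[nu]_y Phi1 (y, z)) * c2| <= eps.
Proof.
move=> bPhi1 uPhi1 bPhi2 uPhi2 a2 eps0.
have [B2 B20 Phi2B] := bounded_funP bPhi2.
have [B1 B10 Phi1B] := bounded_funP bPhi1.
have mPhi1 := measurable_observable uPhi1.
have mPhi2 := measurable_observable uPhi2.
have C0 : 0 < 1 + B2 + `|c2| by rewrite ltr_wpDr// addr_gt0.
pose e := eps / (1 + B2 + `|c2|).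
have e0 : 0 < e by rewrite divr_gt0.
have [s sP] := fibers_totally_bounded compM uPhi1 bPhi1 e0.
have nearP : \forall n \near \oo, forall z', z' \in s -> forall z,
    `|\int[nu]_y (Phi1 (y, z') * Phi2 (iter n f y, z + S n y)) -
      (\int[nu]_y Phi1 (y, z')) * c2| <= e.
  apply: near_seq => z'.
  apply: (equidistribution_continuous compM mf mtau LLT) => //.
  exact: (continuous_fiber uPhi1).
move: nearP; apply: filterS => n Hn z.
have [z' zs zz'] := sP z.
under eq_Rintegral do rewrite iter_skew_product.
have i1 w : nu.-integrable setT (EFin \o (fun y => Phi1 (y, w))).
  exact: (bounded_integrable _ (measurable_fun_slice w mPhi1)
    (fun y => Phi1B _)).
have i12 w : nu.-integrable setT
    (EFin \o (fun y => Phi1 (y, w) * Phi2 (iter n f y, z + S n y))).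
  apply: integrableM_bounded (i1 w) _ (fun y => Phi2B _).
  exact: measurable_orbit.
have b1 : `|\int[nu]_y (Phi1 (y, z) * Phi2 (iter n f y, z + S n y)) -
    \int[nu]_y (Phi1 (y, z') * Phi2 (iter n f y, z + S n y))| <= e * B2.
  rewrite -RintegralB//; apply: normr_Rintegral_bounded.
    apply: measurable_funB; apply: measurable_funM;
      by [exact: measurable_fun_slice|exact: measurable_orbit].
  by move=> y; rewrite -mulrBl normrM ler_pM.
have b2 :
    `|(\int[nu]_y Phi1 (y, z') - \int[nu]_y Phi1 (y, z)) * c2| <= e * `|c2|.
  rewrite normrM ler_wpM2r// -RintegralB//; apply: normr_Rintegral_bounded.
    by apply: measurable_funB; exact: measurable_fun_slice.
  by move=> y; rewrite distrC.
have b3 := Hn z' zs z.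
have <- : e * (1 + B2 + `|c2|) = eps by rewrite divfK// lt0r_neq0.
move: b1 b2 b3; rewrite mulrBl !ler_norml => /andP[? ?] /andP[? ?] /andP[? ?].
by apply/andP; split; lra.
Qed.

Lemma global_global_mixing_LLT : global_global_mixing mu T (GU mu).
Proof.
move=> Phi1 Phi2 c1 c2 [bPhi1 uPhi1 _] [bPhi2 uPhi2 _] a1 a2 /=.
have [B1 B10 Phi1B] := bounded_funP bPhi1.
have [B2 B20 Phi2B] := bounded_funP bPhi2.
have mPhi1 := measurable_observable uPhi1.
have mPhi2 := measurable_observable uPhi2.
pose avg n (zw : Zd d * nat) :=
  cube_average mu (fun x => Phi1 x * Phi2 (iter n T x)) zw.1 zw.2.
suff H eps : 0 < eps -> \forall n \near \oo,
    exists2 V, large_cubes mu V &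
      forall zw, V zw -> `|avg n zw - c1 * c2| <= eps.
  split; apply: cvg_EFin_sandwich => e e0; have := H e e0; apply: filterS.
    move=> n [V lV VP]; apply: (limf_esup_near (u := avg n) lV) VP => V'.
    exact: large_cubes_meet.
  move=> n [V lV VP]; apply: (limf_einf_near (u := avg n) lV) VP => V'.
  exact: large_cubes_meet.
move=> eps0.
have C0 : 0 < 1 + `|c2| by rewrite ltr_wpDr.
pose e := eps / (1 + `|c2|).
have e0 : 0 < e by rewrite divr_gt0.
have [N0 HN0] := a1 e e0.
have := fiber_averages_mixing bPhi1 uPhi1 bPhi2 uPhi2 a2 e0.
apply: filterS => n Hn; exists [set zw | (N0 < zw.2)%N].
  exact: large_cubes_size.
move=> [z w] /= Nw.
have wd0 : 0 < (w ^ d)%:R :> R by rewrite ltr0n expn_gt0 (leq_ltn_trans _ Nw).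
have mF : measurable_fun setT (fun x => Phi1 x * Phi2 (iter n T x)).
  apply: measurable_funM => //.
  exact: (measurableT_comp mPhi2 (measurable_iter_skew_product n)).
have FB x : `|Phi1 x * Phi2 (iter n T x)| <= B1 * B2 by rewrite normrM ler_pM.
have := HN0 z w Nw; rewrite /avg /= (cube_averageE _ _ _ mF FB).
rewrite (cube_averageE _ _ _ mPhi1 Phi1B) => avg1.
set A1 := _ * _ in avg1; set A := _ * _.
have close : `|A - A1 * c2| <= e.
  rewrite /A /A1 -mulrA -mulrBr mulr_suml -sumrB normrM gtr0_norm ?invr_gt0//.
  rewrite mulrC ler_pdivrMr//; apply: le_trans (ler_norm_sum _ _ _) _.
  apply: le_trans (ler_sum _ (fun k _ => Hn (cube_point z k))) _.
  by rewrite sumr_const card_ffun !card_ord -[leLHS]mulr_natr.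
have -> : A - c1 * c2 = (A - A1 * c2) + (A1 - c1) * c2 by ring.
apply: le_trans (ler_normD _ _) _; rewrite normrM.
apply: (@le_trans _ _ (e + e * `|c2|)); first by rewrite lerD// ler_wpM2r.
by rewrite -[X in X + _]mulr1 -mulrDr divfK// lt0r_neq0.
Qed.

End mixing.

Theorem theorem2p5 (disp : measure_display) (R : realType) (d : nat)
    (M : borelMetricType disp R) (nu : probability M R)
    (f : M -> M) (tau : M -> Zd d) (L : nat -> R) :
  (0 < d)%N ->
  compact [set: M] ->
  measurable_fun setT f ->
  (forall A : set M, measurable A -> nu (f @^-1` A) = nu A) ->
  measurable_fun setT tau ->
  shifted_mixing_LLT nu f tau L ->
  let mu := extension_measure d nu in
  let T := skew_product f tau in
  local_global_mixing mu T (GU mu) /\ global_global_mixing mu T (GU mu).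
Proof.
move=> d0 compM mf _ mtau LLT mu T; split.
  exact: (local_global_mixing_LLT compM mf mtau LLT).
exact: (global_global_mixing_LLT d0 compM mf mtau LLT).
Qed.
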